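(* Every finite irreducible nontrivial conformal module over the Schrödinger–Virasoro conformal algebra $\mathcal{SV}$ is isomorphic to a module of the form $$M_{\Delta,\alpha}=\mathbb{C}[\partial]v,\quad L_\lambda v=(\partial+\alpha+\Delta\lambda)v,\quad M_\lambda v=Y_\lambda v=0,$$ free of rank one over $\mathbb{C}[\partial]$ with generator $v$, for some $\Delta\in\mathbb{C}\setminus\{0\}$ and $\alpha\in\mathbb{C}$.
   Context: A Lie conformal algebra is a $\mathbb{C}[\partial]$-module $\mathcal{A}$ with a $\mathbb{C}$-bilinear $\lambda$-bracket $\mathcal{A}\otimes\mathcal{A}\to\mathbb{C}[\lambda]\otimes\mathcal{A}$, $a\otimes b\mapsto[a_\lambda b]$, satisfying $[\partial a_\lambda b]=-\lambda[a_\lambda b]$, $[a_\lambda\partial b]=(\partial+\lambda)[a_\lambda b]$, $[a_\lambda b]=-[b_{-\lambda-\partial}a]$, and $[a_\lambda[b_\mu c]]=[[a_\lambda b]_{\lambda+\mu}c]+[b_\mu[a_\lambda c]]$. A conformal module over $\mathcal{A}$ is a $\mathbb{C}[\partial]$-module $V$ with a $\mathbb{C}$-bilinear map $\mathcal{A}\otimes V\to V[\lambda]$, $a\otimes v\mapsto a_\lambda v$, such that $a_\lambda(b_\mu v)-b_\mu(a_\lambda v)=[a_\lambda b]_{\lambda+\mu}v$, $(\partial a)_\lambda v=-\lambda a_\lambda v$, $a_\lambda(\partial v)=(\partial+\lambda)a_\lambda v$. It is finite if finitely generated over $\mathbb{C}[\partial]$; irreducible if it is nonzero and its only submodules are $0$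 and itself; trivial if $a_\lambda v=0$ for all $a\in\mathcal{A}$, $v\in V$, and nontrivial otherwise. The Schrödinger–Virasoro conformal algebra is $\mathcal{SV}=\mathbb{C}[\partial]L\oplus\mathbb{C}[\partial]M\oplus\mathbb{C}[\partial]Y$, free over $\mathbb{C}[\partial]$ with basis $L,M,Y$, whose nonzero $\lambda$-brackets of generators are $[L_\lambda L]=(\partial+2\lambda)L$, $[L_\lambda Y]=(\partial+\tfrac32\lambda)Y$, $[Y_\lambda L]=(\tfrac12\partial+\tfrac32\lambda)Y$, $[Y_\lambda Y]=(\partial+2\lambda)M$, $[L_\lambda M]=(\partial+\lambda)M$, $[M_\lambda L]=\lambda M$ (so $[M_\lambda M]=[M_\lambda Y]=[Y_\lambda M]=0$). *)

(* Defs.v *)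
From HB Require Import structures.
From mathcomp Require Import all_boot all_order all_algebra.
From mathcomp Require Import finmap monalg ring.

Set Implicit Arguments.
Unset Strict Implicit.
Unset Printing Implicit Defensive.

Import GRing.Theory Num.Theory.
Local Open Scope ring_scope.

(* V[x]: finite sums of terms v x^n.  For a module V over S this is a module
   over S[x] = {poly S}. *)
Definition vpoly (V : zmodType) := {malg V[nat]}.

HB.instance Definition _ (V : zmodType) :=
  GRing.Zmodule.copy (vpoly V) {malg V[nat]}.

Definition vmono (V : zmodType) (n : nat) (v : V) : vpoly V := << v *g n >>.
Definition vcoef (V : zmodType) (n : nat) (f : vpoly V) : V := f@_n.
Definition vconst (V : zmodType) (v : V) : vpoly V := vmono 0 v.

(* sum_n t^n h(f_n); the argument h is meant to be additive *)
Definition vsubst (V : zmodType) (T : nzRingType) (W : lmodType T)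
    (h : V -> W) (t : T) (f : vpoly V) : W :=
  \sum_(n <- msupp f) t ^+ n *: h (vcoef n f).

Section VPolyZmod.
Variable V : zmodType.
Implicit Types f g : vpoly V.

Lemma vpolyP f g : (forall n, vcoef n f = vcoef n g) -> f = g.
Proof. by move=> H; apply/malgP. Qed.

Lemma vcoefD n f g : vcoef n (f + g) = vcoef n f + vcoef n g.
Proof. exact: mcoeffD. Qed.

Lemma vcoef0 n : vcoef n (0 : vpoly V) = 0.
Proof. exact: mcoeff0. Qed.

Lemma vcoefN n f : vcoef n (- f) = - vcoef n f.
Proof. exact: mcoeffN. Qed.

Lemma vcoef_sum (I : Type) (r : seq I) (P : pred I) (F : I -> vpoly V) n :
  vcoef n (\sum_(i <- r | P i) F i) = \sum_(i <- r | P i) vcoef n (F i).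
Proof. exact: raddf_sum. Qed.

Lemma vcoef_mono m n (v : V) : vcoef n (vmono m v) = v *+ (m == n).
Proof. exact: mcoeffU. Qed.

Lemma vcoef_const n (v : V) : vcoef n (vconst v) = v *+ (n == 0)%N.
Proof. by rewrite vcoef_mono eq_sym. Qed.

Lemma sum_msupp (W : zmodType) (F : nat -> W) f k :
  (forall n, vcoef n f = 0 -> F n = 0) ->
  \sum_(n <- msupp f) F n *+ (n == k)%N = F k.
Proof.
move=> F0; have [kf|kf] := boolP (k \in msupp f).
  rewrite (big_fsetD1 k) //= eqxx mulr1n big1_fset ?addr0 // => n.
  by rewrite !inE => /andP[/negPf -> _].
rewrite F0; last exact: mcoeff_outdom.
rewrite big1_fset // => n nf _; case: eqP => // E.
by rewrite -E nf in kf.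
Qed.

End VPolyZmod.

Section VPolyLmod.
Variables (S : nzRingType) (V : lmodType S).
Implicit Types (f g : vpoly V) (p q : {poly S}).

Definition vscale p f : vpoly V :=
  \sum_(i < size p) \sum_(n <- msupp f) vmono (i + n) (p`_i *: vcoef n f).

Lemma vcoef_scale p f k :
  vcoef k (vscale p f) = \sum_(i < k.+1) p`_i *: vcoef (k - i) f.
Proof.
rewrite vcoef_sum.
transitivity (\sum_(i < size p | (i < k.+1)%N) p`_i *: vcoef (k - i) f).
  rewrite [RHS]big_mkcond /=; apply: eq_bigr => i _; rewrite vcoef_sum.
  case: ltnP => [ik|ki].
    rewrite -(@sum_msupp _ _ (fun n => p`_i *: vcoef n f) f (k - i)%N).
      2: by move=> n ->; rewrite scaler0.
    apply: eq_bigr => n _; rewrite vcoef_mono; congr (_ *+ nat_of_bool _).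
    by rewrite -{1}(subnKC (ik : (i <= k)%N)) eqn_add2l.
  rewrite big1 // => n _; rewrite vcoef_mono; case: eqP => // E.
  by rewrite -E ltnNge leq_addr in ki.
rewrite -(big_mkord (fun i => (i < k.+1)%N) (fun i => p`_i *: vcoef (k - i) f)).
rewrite -(big_mkord xpredT (fun i => p`_i *: vcoef (k - i) f)).
rewrite (@big_nat_widen _ _ _ _ k.+1 (maxn (size p) k.+1)) ?leq_maxr //.
rewrite (@big_nat_widen _ _ _ _ (size p) (maxn (size p) k.+1)) ?leq_maxl //.
rewrite big_mkcond [RHS]big_mkcond /=; apply: eq_bigr => i _.
case: ifP => [/andP[-> //]|]; case: (ltnP i k.+1) => //= ik.
by move/negbT; rewrite -leqNgt => ip; rewrite nth_default ?scale0r.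
Qed.

Fact vscaleA p q f : vscale p (vscale q f) = vscale (p * q) f.
Proof.
apply/vpolyP => k; rewrite !vcoef_scale.
pose F i j := p`_i *: (q`_(j - i) *: vcoef (k - j) f).
transitivity (\sum_(i < k.+1) \sum_(j < k.+1 | (i <= j)%N) F i j).
  apply: eq_bigr => i _; rewrite vcoef_scale scaler_sumr.
  rewrite -(big_mkord xpredT (fun j => p`_i *: (q`_j *: vcoef (k - i - j) f))).
  rewrite -(big_mkord (fun j => (i <= j)%N) (F i)).
  have ik : (i <= k)%N by rewrite -ltnS.
  rewrite -(subSn ik).
  rewrite [RHS](big_cat_nat _ (n := i)) //=; last exact: ltnW.
  rewrite [X in _ = X + _]big_nat_cond [X in _ = X + _]big1 ?add0r; last first.
    by move=> j /andP[/andP[_ ji]]; rewrite leqNgt ji.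
  rewrite -[X in _ = \sum_(X <= _ < _ | _) _]add0n big_addn.
  rewrite [RHS]big_mkcond /=; apply: eq_bigr => j _.
  by rewrite /= leq_addl /F addnK addnC subnDA.
rewrite (exchange_big_dep xpredT) //=; apply: eq_bigr => j _.
rewrite coefM scaler_suml.
rewrite -(big_mkord (fun i => (i <= j)%N) (fun i => F i j)).
rewrite -(big_mkord xpredT (fun i => (p`_i * q`_(j - i)) *: vcoef (k - j) f)).
rewrite [RHS](big_nat_widen _ _ k.+1) ?ltn_ord //=.
by apply: eq_big => [i|i _]; rewrite ?ltnS // /F scalerA.
Qed.

Fact vscale1 : left_id 1 vscale.
Proof.
move=> f; apply/vpolyP => k; rewrite vcoef_scale big_ord_recl /= coef1 scale1r.
by rewrite subn0 big1 ?addr0 // => i _; rewrite coef1 scale0r.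
Qed.

Fact vscaleDr : right_distributive vscale +%R.
Proof.
move=> p f g; apply/vpolyP => k; rewrite vcoefD !vcoef_scale -big_split.
by apply: eq_bigr => i _; rewrite vcoefD scalerDr.
Qed.

Fact vscaleDl f : {morph vscale^~ f : p q / p + q}.
Proof.
move=> p q; apply/vpolyP => k; rewrite vcoefD !vcoef_scale -big_split.
by apply: eq_bigr => i _; rewrite coefD scalerDl.
Qed.

HB.instance Definition _ := GRing.Zmodule_isLmodule.Build {poly S} (vpoly V)
  vscaleA vscale1 vscaleDr vscaleDl.

Lemma vcoefZ p f k :
  vcoef k (p *: f) = \sum_(i < k.+1) p`_i *: vcoef (k - i) f.
Proof. exact: vcoef_scale. Qed.

End VPolyLmod.

(* p(x), the coefficients of p being mapped to T by iota *)
Definition peval (S : nzRingType) (T : comNzRingType) (iota : S -> T) (x : T)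
  (p : {poly S}) : T := (map_poly iota p).[x].

Section Conformal.
Variable K : fieldType.

(* K[d] = {poly K} acts on V.  The module V[lambda] is over K[d][lambda] and
   V[lambda, mu] = vpoly (vpoly V) is over K[d][lambda][mu]. *)
Local Notation P1 := {poly K}.
Local Notation P2 := {poly {poly K}}.
Local Notation P3 := {poly {poly {poly K}}}.

Definition d2 : P2 := 'X%:P.
Definition lam2 : P2 := 'X.
Definition lam3 : P3 := 'X%:P.
Definition mu3 : P3 := 'X.

(* f(x) in V[lambda, mu] for f in V[lambda] *)
Definition at2 (V : lmodType P1) (x : P3) (f : vpoly V) : vpoly (vpoly V) :=
  vsubst (fun v => vconst (vconst v)) x f.

(* a_x (b_y v) *)
Definition act_act (A : Type) (V : lmodType P1) (rho : A -> V -> vpoly V)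
    (x : P3) (a : A) (y : P3) (b : A) (v : V) : vpoly (vpoly V) :=
  vsubst (fun w => at2 x (rho a w)) y (rho b v).

(* [a_x b]_y v *)
Definition br_act (A V : lmodType P1) (br : A -> A -> vpoly A)
    (rho : A -> V -> vpoly V) (x y : P3) (a b : A) (v : V) :
    vpoly (vpoly V) :=
  vsubst (fun c => at2 y (rho c v)) x (br a b).

Record lieConformal := LieConformal {
  lc_sort :> lmodType P1;
  lbr : lc_sort -> lc_sort -> vpoly lc_sort;
  lbrDl : forall a a' b, lbr (a + a') b = lbr a b + lbr a' b;
  lbrDr : forall a b b', lbr a (b + b') = lbr a b + lbr a b';
  lbrZl : forall (k : K) a b, lbr (k%:P *: a) b = k%:P%:P *: lbr a b;
  lbrZr : forall (k : K) a b, lbr a (k%:P *: b) = k%:P%:P *: lbr a b;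
  lbr_dl : forall a b, lbr ('X *: a) b = - lam2 *: lbr a b;
  lbr_dr : forall a b, lbr a ('X *: b) = (d2 + lam2) *: lbr a b;
  lbr_skew : forall a b,
    lbr a b = - vsubst (@vconst lc_sort) (- lam2 - d2) (lbr b a);
  lbr_jacobi : forall a b c,
    act_act lbr lam3 a mu3 b c =
    br_act lbr lbr lam3 (lam3 + mu3) a b c + act_act lbr mu3 b lam3 a c
}.

Record confModule (A : lieConformal) := ConfModule {
  cm_sort :> lmodType P1;
  lact : A -> cm_sort -> vpoly cm_sort;
  lactDl : forall a a' v, lact (a + a') v = lact a v + lact a' v;
  lactDr : forall a v v', lact a (v + v') = lact a v + lact a v';
  lactZl : forall (k : K) a v, lact (k%:P *: a) v = k%:P%:P *: lact a v;
  lactZr : forall (k : K) a v, lact a (k%:P *: v) = k%:P%:P *: lact a v;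
  lact_br : forall a b v,
    act_act lact lam3 a mu3 b v - act_act lact mu3 b lam3 a v =
    br_act (@lbr A) lact lam3 (lam3 + mu3) a b v;
  lact_dl : forall a v, lact ('X *: a) v = - lam2 *: lact a v;
  lact_dr : forall a v, lact a ('X *: v) = (d2 + lam2) *: lact a v
}.

Section Modules.
Variable A : lieConformal.
Implicit Types V W : confModule A.

Definition cm_finite V : Prop :=
  exists s : seq V, forall v : V, exists c : 'I_(size s) -> P1,
    v = \sum_(i < size s) c i *: s`_i.

Definition cm_submodule V (U : V -> Prop) : Prop :=
  [/\ U 0, forall u v, U u -> U v -> U (u + v),
      forall (p : P1) u, U u -> U (p *: u)
    & forall (a : A) u, U u -> forall n, U (vcoef n (lact a u))].

Definition cm_irreducible V : Prop :=
  (exists v : V, v <> 0) /\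
  forall U : V -> Prop, cm_submodule U ->
    (forall v, U v <-> v = 0) \/ (forall v, U v).

Definition cm_trivial V : Prop := forall (a : A) (v : V), lact a v = 0.

Definition cm_isomorphic V W : Prop :=
  exists2 f : {linear V -> W}, bijective f &
    forall (a : A) (v : V) n, f (vcoef n (lact a v)) = vcoef n (lact a (f v)).

End Modules.
End Conformal.

Section Eval.
Variables (S : nzRingType) (T : comNzRingType) (iota : {rmorphism S -> T}).

Fact peval_is_zmod_morphism x : zmod_morphism (peval iota x).
Proof. by move=> p q; rewrite /peval rmorphB /= !hornerE. Qed.

Fact peval_is_monoid_morphism x : monoid_morphism (peval iota x).
Proof.
split; first by rewrite /peval rmorph1 hornerC.
by move=> p q; rewrite /peval rmorphM /= !hornerE.
Qed.

HB.instance Definition _ x :=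
  GRing.isZmodMorphism.Build {poly S} T (peval iota x)
    (peval_is_zmod_morphism x).
HB.instance Definition _ x :=
  GRing.isMonoidMorphism.Build {poly S} T (peval iota x)
    (peval_is_monoid_morphism x).

Lemma pevalC x c : peval iota x c%:P = iota c.
Proof. by rewrite /peval map_polyC hornerC. Qed.

Lemma pevalX x : peval iota x 'X = x.
Proof. by rewrite /peval map_polyX hornerX. Qed.

End Eval.

Lemma eq_peval (S : nzRingType) (T : comNzRingType) (f g : S -> T) x p :
  f =1 g -> peval f x p = peval g x p.
Proof. by move=> fg; rewrite /peval (eq_map_poly fg). Qed.

Lemma rmorph_peval (S : nzRingType) (T U : comNzRingType)
    (iota : {rmorphism S -> T}) (phi : {rmorphism T -> U}) x p :
  phi (peval iota x p) = peval (phi \o iota) (phi x) p.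
Proof. by rewrite /peval map_poly_comp horner_map. Qed.

Section Coord.
Variables (S : nzRingType) (V : lmodType S) (k : {linear V -> S^o}).

Definition vcoord (f : vpoly V) : {poly S} :=
  \sum_(n <- msupp f) (k (vcoef n f) : S)%:P * 'X^n.

Lemma coef_vcoord f n : (vcoord f)`_n = k (vcoef n f).
Proof.
rewrite coef_sum -[RHS](@sum_msupp _ S^o (fun n => k (vcoef n f)) f n).
  apply: eq_bigr => i _; rewrite coefCM coefXn eq_sym.
  by case: eqP => _; rewrite ?mulr1 ?mulr0.
by move=> m ->; rewrite linear0.
Qed.

Fact vcoord_is_linear : linear (vcoord : vpoly V -> {poly S}^o).
Proof.
move=> p f g; apply/polyP => n.
rewrite coefD coefM !coef_vcoord vcoefD linearD; congr (_ + _).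
rewrite vcoefZ linear_sum; apply: eq_bigr => i _.
by rewrite linearZ coef_vcoord.
Qed.

HB.instance Definition _ := GRing.isLinear.Build {poly S} (vpoly V)
  {poly S}^o _ vcoord vcoord_is_linear.

Lemma vcoord_const v : vcoord (vconst v) = (k v)%:P.
Proof.
apply/polyP => n; rewrite coef_vcoord vcoef_const coefC.
by case: eqP => // _; rewrite linear0.
Qed.

Lemma vcoord_subst (V' : zmodType) (h : V' -> V) (t : S) (f : vpoly V') :
  k (vsubst h t f) = \sum_(n <- msupp f) t ^+ n * k (h (vcoef n f)) :> S.
Proof. by rewrite linear_sum; apply: eq_bigr => n _; rewrite linearZ. Qed.

Lemma peval_vcoord (T : comNzRingType) (iota : {rmorphism S -> T}) t f :
  peval iota t (vcoord f) =
  \sum_(n <- msupp f) t ^+ n * iota (k (vcoef n f)).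
Proof.
rewrite rmorph_sum; apply: eq_bigr => n _.
by rewrite rmorphM rmorphXn /= pevalC pevalX mulrC.
Qed.

End Coord.

Lemma vcoord_inj (S : nzRingType) (V : lmodType S) (I : Type)
    (k : I -> {linear V -> S^o}) :
  (forall v w, (forall i, k i v = k i w) -> v = w) ->
  forall f g, (forall i, vcoord (k i) f = vcoord (k i) g) -> f = g.
Proof.
move=> kI f g fg; apply: vpolyP => n; apply: kI => i.
by rewrite -!coef_vcoord fg.
Qed.

Section FreeBracket.
Variable K : fieldType.
Local Notation P1 := {poly K}.
Local Notation P2 := {poly {poly K}}.
Local Notation P3 := {poly {poly {poly K}}}.

Local Notation CC := (@polyC P1 \o @polyC K : K -> P2).
Local Notation CC3 := (@polyC P2 \o @polyC P1 : P1 -> P3).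
Local Notation C3 := (CC3 \o @polyC K : K -> P3).

(* The values of a lambda-bracket or lambda-action on basis elements are
   extended to all elements by (p(d) a)_lambda (q(d) v) =
   p(-lambda) q(d + lambda) (a_lambda v). *)
Definition sesqui_ext (n m : nat) (V : lmodType P1)
    (u : 'I_n -> P1) (w : 'I_m -> P1) (g : 'I_n -> 'I_m -> vpoly V) : vpoly V :=
  \sum_(i < n) \sum_(j < m)
    (peval CC (- lam2 K) (u i) * peval CC (d2 K + lam2 K) (w j)) *: g i j.

Section Sesqui.
Variables (n m : nat) (V : lmodType P1) (g : 'I_n -> 'I_m -> vpoly V).

Lemma eq_sesqui u u' w w' : u =1 u' -> w =1 w' ->
  sesqui_ext u w g = sesqui_ext u' w' g.
Proof.
by move=> uu ww; apply: eq_bigr => i _; apply: eq_bigr => j _; rewrite uu ww.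
Qed.

Lemma sesquiDl u u' w :
  sesqui_ext (fun i => u i + u' i) w g = sesqui_ext u w g + sesqui_ext u' w g.
Proof.
rewrite -big_split; apply: eq_bigr => i _; rewrite -big_split /=.
by apply: eq_bigr => j _; rewrite rmorphD mulrDl scalerDl.
Qed.

Lemma sesquiDr u w w' :
  sesqui_ext u (fun j => w j + w' j) g = sesqui_ext u w g + sesqui_ext u w' g.
Proof.
rewrite -big_split; apply: eq_bigr => i _; rewrite -big_split /=.
by apply: eq_bigr => j _; rewrite rmorphD mulrDr scalerDl.
Qed.

Lemma sesquiMl p u w :
  sesqui_ext (fun i => p * u i) w g = peval CC (- lam2 K) p *: sesqui_ext u w g.
Proof.
rewrite scaler_sumr; apply: eq_bigr => i _; rewrite scaler_sumr.
by apply: eq_bigr => j _; rewrite rmorphM scalerA mulrA.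
Qed.

Lemma sesquiMr p u w :
  sesqui_ext u (fun j => p * w j) g =
  peval CC (d2 K + lam2 K) p *: sesqui_ext u w g.
Proof.
rewrite scaler_sumr; apply: eq_bigr => i _; rewrite scaler_sumr.
by apply: eq_bigr => j _; rewrite rmorphM scalerA mulrCA.
Qed.

End Sesqui.

Lemma pevalCC3 (x : P3) (z : P2) (p : P1) :
  peval CC3 x (peval CC z p) = peval C3 (peval CC3 x z) p.
Proof.
rewrite (rmorph_peval CC (peval CC3 x)).
by apply: eq_peval => c /=; rewrite pevalC.
Qed.

Lemma CC3E (p : P1) : CC3 p = peval C3 'X%:P%:P p.
Proof.
rewrite -{1}[p]comp_polyXr /comp_poly -/(peval polyC 'X p).
by rewrite (rmorph_peval _ CC3).
Qed.

Definition ev3 (x y : P3) : P2 -> P3 := peval (peval C3 x) y.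

HB.instance Definition _ x y :=
  GRing.RMorphism.copy (ev3 x y) (peval (peval C3 x) y).

Lemma peval_ev3 (x y : P3) (z : P2) (p : P1) :
  ev3 x y (peval CC z p) = peval C3 (ev3 x y z) p.
Proof.
rewrite /ev3 (rmorph_peval CC (peval (peval C3 x) y)).
by apply: eq_peval => c /=; rewrite pevalC /= pevalC.
Qed.

Lemma CC3_ev3 (x : P3) (f : P2) : peval CC3 x f = ev3 'X%:P%:P x f.
Proof. by rewrite /ev3; apply: eq_peval => p; rewrite -CC3E. Qed.

Section Coords.
Variables (n m : nat) (A V : lmodType P1).
Variables (ka : 'I_n -> {linear A -> P1^o}) (kv : 'I_m -> {linear V -> P1^o}).
Variables (br : A -> A -> vpoly A) (rho : A -> V -> vpoly V).
Variables (H : 'I_n -> 'I_n -> 'I_n -> P2) (G : 'I_n -> 'I_m -> 'I_m -> P2).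
Hypothesis brE : forall k a b, vcoord (ka k) (br a b) =
  \sum_(i < n) \sum_(j < n)
    peval CC (- lam2 K) (ka i a) * peval CC (d2 K + lam2 K) (ka j b) * H i j k.
Hypothesis rhoE : forall k a v, vcoord (kv k) (rho a v) =
  \sum_(i < n) \sum_(j < m)
    peval CC (- lam2 K) (ka i a) * peval CC (d2 K + lam2 K) (kv j v) * G i j k.

Let d3 : P3 := 'X%:P%:P.

Lemma at2_coord k x (f : vpoly V) :
  vcoord (vcoord (kv k)) (at2 x f) = ev3 d3 x (vcoord (kv k) f).
Proof.
rewrite vcoord_subst -CC3_ev3 peval_vcoord; apply: eq_bigr => i _.
by rewrite /= vcoord_const /= vcoord_const.
Qed.

Lemma rho_ev3 k x y a v : ev3 x y (vcoord (kv k) (rho a v)) =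
  \sum_(i < n) \sum_(j < m)
    peval C3 (- y) (ka i a) * peval C3 (x + y) (kv j v) * ev3 x y (G i j k).
Proof.
rewrite rhoE rmorph_sum; apply: eq_bigr => i _; rewrite rmorph_sum.
apply: eq_bigr => j _; rewrite !rmorphM /= !peval_ev3.
by rewrite rmorphN rmorphD /= /ev3 pevalX pevalC /= pevalX.
Qed.

Lemma act_act_coord k x y a b v :
  vcoord (vcoord (kv k)) (act_act rho x a y b v) =
  \sum_(i < n) \sum_(j < m) \sum_(i' < n) \sum_(j' < m)
    peval C3 (- x) (ka i a) * ev3 d3 x (G i j k) *
    (peval C3 (- y) (ka i' b) * peval C3 (d3 + x + y) (kv j' v) *
     ev3 (d3 + x) y (G i' j' j)).
Proof.
rewrite vcoord_subst.
under eq_bigr => l _ do rewrite /= at2_coord rho_ev3 mulr_sumr.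
rewrite exchange_big; apply: eq_bigr => i _ /=.
under eq_bigr => l _ do rewrite mulr_sumr.
rewrite exchange_big; apply: eq_bigr => j _ /=.
transitivity (peval C3 (- x) (ka i a) * ev3 d3 x (G i j k) *
   ev3 (d3 + x) y (vcoord (kv j) (rho b v))).
  rewrite [in RHS]/ev3 peval_vcoord mulr_sumr; apply: eq_bigr => l _.
  by rewrite [RHS]mulrCA mulrAC.
rewrite rho_ev3 mulr_sumr; apply: eq_bigr => i' _.
by rewrite mulr_sumr; apply: eq_bigr => j' _.
Qed.

Lemma br_act_coord k x y a b v :
  vcoord (vcoord (kv k)) (br_act br rho x y a b v) =
  \sum_(i < n) \sum_(j < m) \sum_(i' < n) \sum_(j' < n)
    peval C3 (- x) (ka i' a) * peval C3 (x - y) (ka j' b) *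
    ev3 (- y) x (H i' j' i) * (peval C3 (d3 + y) (kv j v) * ev3 d3 y (G i j k)).
Proof.
rewrite vcoord_subst.
under eq_bigr => l _ do rewrite /= at2_coord rho_ev3 mulr_sumr.
rewrite exchange_big; apply: eq_bigr => i _ /=.
under eq_bigr => l _ do rewrite mulr_sumr.
rewrite exchange_big; apply: eq_bigr => j _ /=.
transitivity (ev3 (- y) x (vcoord (ka i) (br a b)) *
   (peval C3 (d3 + y) (kv j v) * ev3 d3 y (G i j k))).
  rewrite [in RHS]/ev3 peval_vcoord mulr_suml; apply: eq_bigr => l _.
  by rewrite !mulrA.
rewrite brE rmorph_sum mulr_suml; apply: eq_bigr => i' _.
rewrite rmorph_sum mulr_suml; apply: eq_bigr => j' _.
rewrite !rmorphM /= !peval_ev3.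
by rewrite rmorphN rmorphD /= /ev3 pevalX pevalC /= pevalX [- y + x]addrC.
Qed.

End Coords.

End FreeBracket.

Section SchrodingerVirasoro.
Variable K : numFieldType.
Local Notation P1 := {poly K}.
Local Notation P2 := {poly {poly K}}.
Local Notation P3 := {poly {poly {poly K}}}.
Local Notation C2 := (@polyC {poly K} \o @polyC K).

Local Notation iL := (@Ordinal 3 0 isT).
Local Notation iM := (@Ordinal 3 1 isT).
Local Notation iY := (@Ordinal 3 2 isT).

(* K[d]L + K[d]M + K[d]Y in the coordinates (L, M, Y) *)
Local Notation SVmod := 'rV[P1]_3.
Definition svL : SVmod := delta_mx 0 iL.
Definition svM : SVmod := delta_mx 0 iM.
Definition svY : SVmod := delta_mx 0 iY.

Definition SVgen (i j : 'I_3) : vpoly SVmod :=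
  match val i, val j with
  | 0%N, 0%N => (d2 K + 2 * lam2 K) *: vconst svL
  | 0%N, 1%N => (d2 K + lam2 K) *: vconst svM
  | 0%N, 2%N => (d2 K + (3 / 2)%:P%:P * lam2 K) *: vconst svY
  | 1%N, 0%N => lam2 K *: vconst svM
  | 2%N, 0%N => ((1 / 2)%:P%:P * d2 K + (3 / 2)%:P%:P * lam2 K) *: vconst svY
  | 2%N, 2%N => (d2 K + 2 * lam2 K) *: vconst svM
  | _, _ => 0
  end.

Definition SVbr (a b : SVmod) : vpoly SVmod :=
  sesqui_ext (fun i => a 0 i) (fun j => b 0 j) SVgen.

Definition svcoord (k : 'I_3) (a : SVmod) : P1^o := a 0 k.

Fact svcoord_is_linear k : linear (svcoord k).
Proof. by move=> p a b; rewrite /svcoord !mxE. Qed.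

HB.instance Definition _ k := GRing.isLinear.Build P1 SVmod P1^o _
  (svcoord k) (svcoord_is_linear k).

Lemma svcoord_inj (a b : SVmod) :
  (forall k, svcoord k a = svcoord k b) -> a = b.
Proof. by move=> ab; apply/rowP => k; apply: ab. Qed.

Definition SVtab (i j k : 'I_3) : P2 :=
  match val i, val j, val k with
  | 0%N, 0%N, 0%N => d2 K + 2 * lam2 K
  | 0%N, 1%N, 1%N => d2 K + lam2 K
  | 0%N, 2%N, 2%N => d2 K + (3 / 2)%:P%:P * lam2 K
  | 1%N, 0%N, 1%N => lam2 K
  | 2%N, 0%N, 2%N => (1 / 2)%:P%:P * d2 K + (3 / 2)%:P%:P * lam2 K
  | 2%N, 2%N, 1%N => d2 K + 2 * lam2 K
  | _, _, _ => 0
  end.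

Lemma ord3P (i : 'I_3) : [\/ i = iL, i = iM | i = iY].
Proof.
by case: i => [[|[|[|//]]] lti]; [constructor 1|constructor 2|constructor 3];
  apply: val_inj.
Qed.

Let SVtab2 (T : comNzRingType) (x y : T) (i j k : 'I_3) : T :=
  match val i, val j, val k with
  | 0%N, 0%N, 0%N => 2 * x + 4 * y
  | 0%N, 1%N, 1%N => 2 * x + 2 * y
  | 0%N, 2%N, 2%N => 2 * x + 3 * y
  | 1%N, 0%N, 1%N => 2 * y
  | 2%N, 0%N, 2%N => x + 3 * y
  | 2%N, 2%N, 1%N => 2 * x + 4 * y
  | _, _, _ => 0
  end.

Lemma SVgen_coord i j k : vcoord (svcoord k) (SVgen i j) = SVtab i j k.
Proof.
have E l : vcoord (svcoord k) (vconst (delta_mx 0 l)) = (l == k)%:R.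
  by rewrite vcoord_const /= /svcoord mxE eqxx eq_sym -[RHS]polyC_natr.
case: (ord3P i) => ->; case: (ord3P j) => ->;
  rewrite /SVgen /= ?linear0 ?linearZ /= ?E; case: (ord3P k) => -> /=.
all: by rewrite /SVtab /= ?scaler0 // [LHS]mulr1.
Qed.

Lemma SVbr_coord k a b : vcoord (svcoord k) (SVbr a b) =
  \sum_(i < 3) \sum_(j < 3)
    peval C2 (- lam2 K) (svcoord i a) * peval C2 (d2 K + lam2 K) (svcoord j b) *
    SVtab i j k.
Proof.
rewrite /SVbr linear_sum; apply: eq_bigr => i _.
rewrite linear_sum; apply: eq_bigr => j _.
by rewrite linearZ /= SVgen_coord.
Qed.

Lemma SVbr_gen (i j : 'I_3) :
  SVbr (delta_mx 0 i) (delta_mx 0 j) = SVgen i j.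
Proof.
rewrite /SVbr /sesqui_ext (bigD1 i) //= (bigD1 j) //= !mxE !eqxx !rmorph1.
rewrite mulr1 scale1r !big1 ?addr0 // => [i' /negPf ii'|j' /negPf jj'].
  by apply: big1 => j' _; rewrite mxE ii' andbF rmorph0 mul0r scale0r.
by rewrite !mxE jj' andbF rmorph0 mulr0 scale0r.
Qed.

Fact SVbrDl a a' b : SVbr (a + a') b = SVbr a b + SVbr a' b.
Proof. by rewrite -sesquiDl; apply: eq_sesqui => // i; rewrite mxE. Qed.

Fact SVbrDr a b b' : SVbr a (b + b') = SVbr a b + SVbr a b'.
Proof. by rewrite -sesquiDr; apply: eq_sesqui => // i; rewrite mxE. Qed.

Fact SVbrMl p a b : SVbr (p *: a) b = peval C2 (- lam2 K) p *: SVbr a b.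
Proof. by rewrite -sesquiMl; apply: eq_sesqui => // i; rewrite mxE. Qed.

Fact SVbrMr p a b : SVbr a (p *: b) = peval C2 (d2 K + lam2 K) p *: SVbr a b.
Proof. by rewrite -sesquiMr; apply: eq_sesqui => // i; rewrite mxE. Qed.

Fact SVbrZl (k : K) a b : SVbr (k%:P *: a) b = k%:P%:P *: SVbr a b.
Proof. by rewrite SVbrMl pevalC. Qed.

Fact SVbrZr (k : K) a b : SVbr a (k%:P *: b) = k%:P%:P *: SVbr a b.
Proof. by rewrite SVbrMr pevalC. Qed.

Fact SVbr_dl a b : SVbr ('X *: a) b = - lam2 K *: SVbr a b.
Proof. by rewrite SVbrMl pevalX. Qed.

Fact SVbr_dr a b : SVbr a ('X *: b) = (d2 K + lam2 K) *: SVbr a b.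
Proof. by rewrite SVbrMr pevalX. Qed.

Let half : P2 := (1 / 2)%:P%:P.

Let half2 : half * 2 = 1.
Proof. by rewrite /half mulr_natr mulr2n -!polyCD -splitr. Qed.

Let SVtabE i j k : SVtab i j k = half * SVtab2 (d2 K) (lam2 K) i j k.
Proof.
have E32 : (3 / 2)%:P%:P = half * 3 :> P2.
  by rewrite /half mulr_natr -!polyCMn -mulrnAl.
rewrite /SVtab E32 -/half /SVtab2.
case: (ord3P i) => ->; case: (ord3P j) => ->; case: (ord3P k) => -> /=;
  rewrite ?mulr0 //; first [ring
    | rewrite -[LHS]mul1r -[X in X * _ = _]half2; ring
    | rewrite -{1}[d2 K]mul1r -[X in X * _ + _ = _]half2; ring].
Qed.

Let SVtab_ev3 x y i j k :
  ev3 x y (SVtab i j k) = ev3 x y half * SVtab2 x y i j k.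
Proof.
rewrite SVtabE rmorphM /=; congr (_ * _); rewrite /SVtab2.
case: (ord3P i) => ->; case: (ord3P j) => ->; case: (ord3P k) => -> /=;
 by rewrite ?rmorph0 ?rmorphD ?rmorphM ?rmorph_nat /= /ev3 ?pevalX ?pevalC /=
   ?pevalX.
Qed.

Let ev3_half x y : ev3 x y half = (1 / 2)%:P%:P%:P.
Proof. by rewrite /ev3 /half pevalC /= pevalC. Qed.

Let jacobi (T : comNzRingType) (d x y h : T) (a b c : 'I_3 -> T) k :
  \sum_(i < 3) \sum_(j < 3) \sum_(i' < 3) \sum_(j' < 3)
    a i * (h * SVtab2 d x i j k) *
    (b i' * c j' * (h * SVtab2 (d + x) y i' j' j)) =
  \sum_(i < 3) \sum_(j < 3) \sum_(i' < 3) \sum_(j' < 3)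
    a i' * b j' * (h * SVtab2 (- (x + y)) x i' j' i) *
    (c j * (h * SVtab2 d (x + y) i j k)) +
  \sum_(i < 3) \sum_(j < 3) \sum_(i' < 3) \sum_(j' < 3)
    b i * (h * SVtab2 d y i j k) *
    (a i' * c j' * (h * SVtab2 (d + y) x i' j' j)).
Proof.
have E1 d' x' (u : 'I_3 -> T) (F : 'I_3 -> 'I_3 -> 'I_3 -> T) l :
    \sum_(i < 3) \sum_(j < 3) \sum_(i' < 3) \sum_(j' < 3)
      u i * (h * SVtab2 d' x' i j l) * F i' j' j
    = \sum_(i < 3) \sum_(j < 3)
      (h * u i * \sum_(i' < 3) \sum_(j' < 3) F i' j' j) * SVtab2 d' x' i j l.
  apply: eq_bigr => i _; apply: eq_bigr => j _.
  rewrite [RHS]mulrAC mulr_sumr; apply: eq_bigr => i' _.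
  by rewrite mulr_sumr; apply: eq_bigr => j' _; ring.
have E2 d' x' (F : 'I_3 -> 'I_3 -> T) :
    \sum_(i < 3) \sum_(j < 3) \sum_(i' < 3) \sum_(j' < 3)
      F i' j' * (h * SVtab2 d' x' i' j' i) *
      (c j * (h * SVtab2 d (x + y) i j k))
    = \sum_(i < 3) \sum_(j < 3)
      (h * c j * \sum_(i' < 3) \sum_(j' < 3)
         F i' j' * (h * SVtab2 d' x' i' j' i)) * SVtab2 d (x + y) i j k.
  apply: eq_bigr => i _; apply: eq_bigr => j _.
  rewrite [RHS]mulrAC mulr_sumr; apply: eq_bigr => i' _.
  by rewrite mulr_sumr; apply: eq_bigr => j' _; ring.
have tabS d' x' (F : 'I_3 -> 'I_3 -> T) l :
    \sum_(i < 3) \sum_(j < 3) F i j * SVtab2 d' x' i j l =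
    match val l with
    | 0%N => F iL iL * (2 * d' + 4 * x')
    | 1%N => F iL iM * (2 * d' + 2 * x') + F iM iL * (2 * x')
             + F iY iY * (2 * d' + 4 * x')
    | _ => F iL iY * (2 * d' + 3 * x') + F iY iL * (d' + 3 * x')
    end.
  rewrite !big_ord_recl !big_ord0 /SVtab2.
  have -> : ord0 = iL by exact: val_inj.
  have -> : lift iL (ord0 : 'I_2) = iM by exact: val_inj.
  have -> : lift iL (lift ord0 (ord0 : 'I_1)) = iY by exact: val_inj.
  by case: (ord3P l) => -> /=; rewrite !(mulr0, addr0, add0r) ?addrA.
have tabSh d' x' (F : 'I_3 -> 'I_3 -> T) l :
    \sum_(i < 3) \sum_(j < 3) F i j * (h * SVtab2 d' x' i j l) =
    h * \sum_(i < 3) \sum_(j < 3) F i j * SVtab2 d' x' i j l.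
  rewrite mulr_sumr; apply: eq_bigr => i _; rewrite mulr_sumr.
  by apply: eq_bigr => j _; rewrite mulrCA.
rewrite [LHS](E1 d x a
  (fun i' j' j => b i' * c j' * (h * SVtab2 (d + x) y i' j' j))).
rewrite [X in _ = X + _](E2 (- (x + y)) x (fun i' j' => a i' * b j')).
rewrite [X in _ = _ + X](E1 d y b
  (fun i' j' j => a i' * c j' * (h * SVtab2 (d + y) x i' j' j))).
by rewrite !tabS; case: (ord3P k) => -> /=; rewrite !tabSh !tabS /=; ring.
Qed.

Let ev2 : {rmorphism P2 -> P2} := peval polyC (- lam2 K - d2 K).

Let ev2_C2 z p : ev2 (peval C2 z p) = peval C2 (ev2 z) p.
Proof.
rewrite (rmorph_peval C2 ev2).
by apply: eq_peval => c /=; rewrite pevalC.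
Qed.

Let ev2_tab i j k : ev2 (SVtab i j k) = - SVtab j i k.
Proof.
have e : ev2 (SVtab2 (d2 K) (lam2 K) i j k) = - SVtab2 (d2 K) (lam2 K) j i k.
  rewrite /SVtab2.
  case: (ord3P i) => ->; case: (ord3P j) => ->; case: (ord3P k) => -> /=;
    rewrite ?rmorph0 ?oppr0 ?rmorphD ?rmorphM ?rmorph_nat /= ?pevalX ?pevalC //;
    by rewrite -/(d2 K); ring.
by rewrite !SVtabE rmorphM e /= pevalC mulrN.
Qed.

Fact SVbr_skew a b :
  SVbr a b = - vsubst (@vconst SVmod) (- lam2 K - d2 K) (SVbr b a).
Proof.
apply: (vcoord_inj svcoord_inj) => k; rewrite raddfN /= vcoord_subst.
under [in RHS]eq_bigr => n _ do rewrite /= vcoord_const.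
rewrite -(peval_vcoord _ polyC) -/(ev2 _) !SVbr_coord rmorph_sum.
under [in RHS]eq_bigr => i _ do rewrite rmorph_sum.
rewrite exchange_big -sumrN; apply: eq_bigr => i _.
rewrite -sumrN; apply: eq_bigr => j _.
rewrite !rmorphM /= !ev2_C2 ev2_tab mulrN opprK.
have -> : ev2 (- lam2 K) = d2 K + lam2 K.
  by rewrite rmorphN /= pevalX opprD !opprK addrC.
have -> : ev2 (d2 K + lam2 K) = - lam2 K.
  by rewrite rmorphD /= pevalX pevalC /= addrC subrK.
by rewrite [peval C2 (- lam2 K) _ * _]mulrC.
Qed.

Fact SVbr_jacobi a b c :
  act_act SVbr (lam3 K) a (mu3 K) b c =
  br_act SVbr SVbr (lam3 K) (lam3 K + mu3 K) a b c
  + act_act SVbr (mu3 K) b (lam3 K) a c.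
Proof.
pose ka k : {linear SVmod -> P1^o} := svcoord k.
apply: (@vcoord_inj _ _ _ (fun k => vcoord (ka k))) => [|k].
  exact: (@vcoord_inj _ _ _ ka svcoord_inj).
rewrite [RHS]raddfD.
rewrite [LHS](@act_act_coord K 3 3 SVmod SVmod ka ka SVbr SVtab SVbr_coord).
rewrite [X in _ = _ + X](@act_act_coord K 3 3 SVmod SVmod ka ka SVbr SVtab
  SVbr_coord).
rewrite [X in _ = X + _](@br_act_coord K 3 3 SVmod SVmod ka ka SVbr SVbr SVtab
  SVtab SVbr_coord SVbr_coord).
pose C3 := (@polyC P2 \o @polyC P1) \o @polyC K.
pose pe (x : P3) (u : SVmod) i := peval C3 x (ka i u).
have lm : lam3 K - (lam3 K + mu3 K) = - mu3 K by rewrite opprD addNKr.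
apply: etrans; last first.
  apply: etrans; first exact: (jacobi 'X%:P%:P (lam3 K) (mu3 K) ((1 / 2)%:P%:P%:P)
    (pe (- lam3 K) a) (pe (- mu3 K) b) (pe ('X%:P%:P + lam3 K + mu3 K) c) k).
  by congr (_ + _); do 4 (apply: eq_bigr => ? _);
    rewrite !SVtab_ev3 !ev3_half ?lm ?addrA ?(addrAC _ (mu3 K)).
by do 4 (apply: eq_bigr => ? _); rewrite !SVtab_ev3 !ev3_half.
Qed.

Definition SV : lieConformal K :=
  LieConformal SVbrDl SVbrDr SVbrZl SVbrZr SVbr_dl SVbr_dr SVbr_skew SVbr_jacobi.

Section RankOne.
Variables Delta alpha : K.

(* M_{Delta, alpha}, with carrier K[d] and v = 1 *)
Definition Mgen (i : 'I_3) (_ : 'I_1) : vpoly P1^o :=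
  if i == iL then
    (d2 K + alpha%:P%:P + Delta%:P%:P * lam2 K) *: vconst (1 : P1^o)
  else 0.

Definition Mact (a : SV) (g : P1^o) : vpoly P1^o :=
  sesqui_ext (fun i => (a : SVmod) 0 i) (fun=> g : P1) Mgen.

Let Mtab (i : 'I_3) (_ _ : 'I_1) : P2 :=
  if i == iL then d2 K + alpha%:P%:P + Delta%:P%:P * lam2 K else 0.

Let kv (_ : 'I_1) : {linear P1^o -> P1^o} := idfun.
Let ka k : {linear SVmod -> P1^o} := svcoord k.

Let Mact_coord k a g : vcoord (kv k) (Mact a g) =
  \sum_(i < 3) \sum_(j < 1)
    peval C2 (- lam2 K) (ka i a) * peval C2 (d2 K + lam2 K) (kv j g) *
    Mtab i j k.
Proof.
rewrite /Mact linear_sum; apply: eq_bigr => i _.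
rewrite linear_sum; apply: eq_bigr => j _.
rewrite linearZ /= /Mgen /Mtab; case: ifP => _; last by rewrite linear0.
by rewrite linearZ /= vcoord_const [X in _ * X = _]mulr1.
Qed.

Lemma Mact_gen (i : 'I_3) : Mact (delta_mx 0 i) 1 = Mgen i ord0.
Proof.
rewrite /Mact /sesqui_ext (bigD1 i) //= big_ord1 mxE !eqxx !rmorph1.
rewrite mulr1 scale1r big1 ?addr0 // => i' /negPf ii'.
by rewrite big_ord1 mxE ii' andbF rmorph0 mul0r scale0r.
Qed.

Fact MactDl a a' v : Mact (a + a') v = Mact a v + Mact a' v.
Proof. by rewrite -sesquiDl; apply: eq_sesqui => // i; rewrite mxE. Qed.

Fact MactDr a v v' : Mact a (v + v') = Mact a v + Mact a v'.
Proof. by rewrite -sesquiDr. Qed.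

Fact MactMl p a v : Mact (p *: a) v = peval C2 (- lam2 K) p *: Mact a v.
Proof. by rewrite -sesquiMl; apply: eq_sesqui => // i; rewrite mxE. Qed.

Fact MactMr p a v : Mact a (p *: v) = peval C2 (d2 K + lam2 K) p *: Mact a v.
Proof. by rewrite -sesquiMr. Qed.

Fact MactZl (k : K) a v : Mact (k%:P *: a) v = k%:P%:P *: Mact a v.
Proof. by rewrite MactMl pevalC. Qed.

Fact MactZr (k : K) a v : Mact a (k%:P *: v) = k%:P%:P *: Mact a v.
Proof. by rewrite MactMr pevalC. Qed.

Fact Mact_dl a v : Mact ('X *: a) v = - lam2 K *: Mact a v.
Proof. by rewrite MactMl pevalX. Qed.

Fact Mact_dr a v : Mact a ('X *: v) = (d2 K + lam2 K) *: Mact a v.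
Proof. by rewrite MactMr pevalX. Qed.

Let Mtab_ev3 x y i j k : ev3 x y (Mtab i j k) =
  if i == iL then x + alpha%:P%:P%:P + Delta%:P%:P%:P * y else 0.
Proof.
rewrite /Mtab; case: ifP => _; last exact: rmorph0.
by rewrite !rmorphD rmorphM /= /ev3 !pevalC /= !pevalC pevalX /= pevalX.
Qed.

Let SVtab_L x y i j : ev3 x y (SVtab i j iL) =
  if (i == iL) && (j == iL) then x + 2 * y else 0.
Proof.
case: (ord3P i) => ->; case: (ord3P j) => ->; rewrite /SVtab /= ?rmorph0 //.
by rewrite rmorphD rmorphM rmorph_nat /= /ev3 pevalC /= !pevalX.
Qed.

Let rank1_id (T : comNzRingType) (d x y D al A B V : T) :
  A * (d + al + D * x) * (B * V * (d + x + al + D * y)) -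
  B * (d + al + D * y) * (A * V * (d + y + al + D * x)) =
  A * B * (- (x + y) + 2 * x) * (V * (d + al + D * (x + y))).
Proof. ring. Qed.

Fact Mact_br a b v :
  act_act Mact (lam3 K) a (mu3 K) b v - act_act Mact (mu3 K) b (lam3 K) a v =
  br_act (@lbr K SV) Mact (lam3 K) (lam3 K + mu3 K) a b v.
Proof.
apply: (@vcoord_inj _ _ _ (fun k => vcoord (kv k))) => [|k].
  by apply: (@vcoord_inj _ _ _ kv) => u w /(_ ord0).
pose C3 := (@polyC P2 \o @polyC P1) \o @polyC K.
pose m (x y : P3) := x + alpha%:P%:P%:P + Delta%:P%:P%:P * y.
pose d3 : P3 := 'X%:P%:P.
have S1 (F : 'I_3 -> P3) : (forall i, i != iL -> F i = 0) ->
    \sum_(i < 3) F i = F iL.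
  by move=> F0; rewrite (bigD1 iL) //= big1 ?addr0.
have actE x y a' b' : vcoord (vcoord (kv k)) (act_act Mact x a' y b' v) =
    peval C3 (- x) (ka iL a') * m d3 x *
    (peval C3 (- y) (ka iL b') * peval C3 (d3 + x + y) v * m (d3 + x) y).
  rewrite [LHS](@act_act_coord K 3 1 SVmod P1^o ka kv Mact Mtab Mact_coord).
  rewrite S1 => [|i /negPf iL0]; last first.
    rewrite big_ord1 big1 // => i' _.
    by rewrite big_ord1 Mtab_ev3 iL0 mulr0 mul0r.
  rewrite big_ord1 S1 => [|i /negPf iL0]; last first.
    by rewrite big_ord1 [X in _ * (_ * X)]Mtab_ev3 iL0 !mulr0.
  by rewrite big_ord1 !Mtab_ev3.
have brE : vcoord (vcoord (kv k))
      (br_act SVbr Mact (lam3 K) (lam3 K + mu3 K) a b v) =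
    peval C3 (- lam3 K) (ka iL a) *
    peval C3 (lam3 K - (lam3 K + mu3 K)) (ka iL b) *
    (- (lam3 K + mu3 K) + 2 * lam3 K) *
    (peval C3 (d3 + (lam3 K + mu3 K)) v * m d3 (lam3 K + mu3 K)).
  rewrite [LHS](@br_act_coord K 3 1 SVmod P1^o ka kv SVbr Mact SVtab Mtab
    SVbr_coord Mact_coord).
  rewrite S1 => [|i /negPf iL0]; last first.
    rewrite big_ord1 big1 // => i' _; rewrite big1 // => j' _.
    by rewrite Mtab_ev3 iL0 !mulr0.
  rewrite big_ord1 S1 => [|i /negPf iL0]; last first.
    by rewrite big1 // => j' _; rewrite SVtab_L iL0 mulr0 mul0r.
  rewrite S1 => [|i /negPf iL0]; last first.
    by rewrite SVtab_L iL0 mulr0 mul0r.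
  by rewrite SVtab_L Mtab_ev3.
rewrite [LHS]raddfB.
rewrite [X in X - _]actE [X in _ - X]actE [RHS]brE.
rewrite (_ : lam3 K - _ = - mu3 K); last by rewrite opprD addNKr.
rewrite (_ : d3 + mu3 K + lam3 K = d3 + (lam3 K + mu3 K)); last first.
  by rewrite addrAC addrA.
rewrite -[d3 + lam3 K + mu3 K]addrA.
exact: rank1_id.
Qed.

Definition Mmod : confModule SV :=
  ConfModule MactDl MactDr MactZl MactZr Mact_br Mact_dl Mact_dr.

End RankOne.

End SchrodingerVirasoro.

(* Main.v *)
From HB Require Import structures.
Require Import Defs.
From mathcomp Require Import all_boot all_order all_algebra.
From mathcomp Require Import finmap monalg ring.
From mathcomp Require Import boolp reals complex.

(* Write a_lambda v = sum_n lambda^n a_n v for a = L, M, Y, and x = d + lambda.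
   Re-expanded in powers of x, a_lambda becomes K[x]-linear from V to V[x], so
   if V is finitely generated its coefficients span a finite dimensional space.
   As no nonzero vector of an irreducible nontrivial V is killed by all the
   a_n, the vectors killed by a_n for all n >= N form a finite dimensional
   space V_N.  The operators L_0 - d and M_0 commute with the whole action, so
   they have an eigenvector in some V_N and are scalars by irreducibility.  An
   eigenvector u in V_N of L_1 (the energy operator) with lowest eigenvalue is
   killed by all operators of positive degree.  The vectors Y_0^k u lie in V_3
   and have distinct eigenvalues, so Y_0^(k+1) u = 0 <> Y_0^k u for some k; as
   [Y_1, Y_0] = M_0 is a scalar, this forces M_0 = 0.  The subspaces killed by
   M, and then by Y, are thus nonzero submodules, hence M = Y = 0 on V.  What
   remains is that u generates V freely over K[d]. *)

Set Implicit Arguments.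
Unset Strict Implicit.
Unset Printing Implicit Defensive.

Import GRing.Theory Num.Theory.
Local Open Scope ring_scope.

Local Notation iL := (@Ordinal 3 0 isT).
Local Notation iM := (@Ordinal 3 1 isT).
Local Notation iY := (@Ordinal 3 2 isT).

(** * Coefficients in V[lambda] and V[lambda, mu] *)

Section VPoly.
Variables (S : nzRingType) (V : lmodType S).
Implicit Types (f g : vpoly V) (p : {poly S}).

Lemma vpoly_bound f : exists B, forall n, (B <= n)%N -> vcoef n f = 0.
Proof.
exists (\max_(n <- msupp f) n).+1 => n ltn; apply: mcoeff_outdom.
by apply: contraL ltn => fn; rewrite -leqNgt (@leq_bigmax_seq _ _ xpredT id).
Qed.

Lemma sum_msupp_bound (W : zmodType) (F : nat -> W) f B :
  (forall n, vcoef n f = 0 -> F n = 0) ->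
  (forall n, (B <= n)%N -> vcoef n f = 0) ->
  \sum_(n <- msupp f) F n = \sum_(n < B) F n.
Proof.
move=> F0 fB; under [RHS]eq_bigr => k _ do rewrite -(sum_msupp k F0).
rewrite exchange_big big_seq [RHS]big_seq; apply: eq_bigr => n nf.
have ltnB : (n < B)%N.
  rewrite ltnNge; apply/negP => /fB /eqP; rewrite -[_ == 0]negbK.
  by rewrite -mcoeff_neq0 in nf; rewrite nf.
rewrite (bigD1 (Ordinal ltnB)) //= eqxx big1 ?addr0 // => k.
by rewrite -val_eqE /= eq_sym => /negPf->.
Qed.

Lemma vcoefZ_const p (v : V) n : vcoef n (p *: vconst v) = p`_n *: v.
Proof.
rewrite vcoefZ (bigD1 ord_max) //= subnn vcoef_const mulr1n big1 ?addr0 // => i.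
rewrite -val_eqE /= vcoef_const subn_eq0 => ni; rewrite leqNgt.
by rewrite ltn_neqAle ni -ltnS ltn_ord scaler0.
Qed.

Lemma vcoefCZ (s : S) f n : vcoef n (s%:P *: f) = s *: vcoef n f.
Proof.
rewrite vcoefZ big_ord_recl coefC subn0 big1 ?addr0 // => i _.
by rewrite coefC scale0r.
Qed.

Lemma vcoefXZ f n :
  vcoef n ('X *: f) = if n is n'.+1 then vcoef n' f else 0.
Proof.
rewrite vcoefZ big_ord_recl coefX scale0r add0r; case: n => [|n].
  by rewrite big_ord0.
rewrite big_ord_recl coefX scale1r /= subn1 big1 ?addr0 // => i _.
by rewrite coefX scale0r.
Qed.

End VPoly.

Section At2.
Variables (K : fieldType) (V : lmodType {poly K}).
Local Notation P3 := {poly {poly {poly K}}}.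

Lemma vcoef_at2 (x y : P3) (f : vpoly V) n m :
  vcoef m (vcoef n (y *: at2 x f)) =
  \sum_(k <- msupp f) (y * x ^+ k)`_n`_m *: vcoef k f.
Proof.
rewrite /at2 /vsubst scaler_sumr !vcoef_sum; apply: eq_bigr => k _.
by rewrite scalerA vcoefZ_const vcoefZ_const.
Qed.

(** The outer variable of [P3] is mu, so the outer index [n] counts powers of mu and the inner index
    [m] powers of lambda. *)
Lemma coef_lamX_muX j k n m :
  ((lam3 K) ^+ j * (mu3 K) ^+ k)`_n`_m = ((j == m) && (k == n))%:R.
Proof.
rewrite -rmorphXn /= mulrC coefMC coefXn eq_sym.
case: eqP => _; last by rewrite mul0r coef0 andbF.
by rewrite mul1r coefXn eq_sym andbT.
Qed.

Lemma coef_lamDmu k n m :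
  ((lam3 K + mu3 K) ^+ k)`_n`_m = ((k == m + n)%N * 'C(m + n, n))%:R.
Proof.
have E i : ((lam3 K) ^+ (k - i)%N * (mu3 K) ^+ i *+ 'C(k, i))`_n`_m =
    ((((k - i)%N == m) && (i == n)) * 'C(k, i))%:R.
  by rewrite !coefMn coef_lamX_muX -mulrnA.
rewrite exprDn !coef_sum.
under eq_bigr => i _ do rewrite E.
have [nk|kn] := leqP n k; last first.
  rewrite (_ : (k == m + n)%N = false); last first.
    by apply/negbTE; rewrite neq_ltn (leq_trans kn) ?leq_addl.
  rewrite big1 // => i _; rewrite (_ : (i == n :> nat) = false) ?andbF //.
  by apply/negbTE; rewrite neq_ltn (leq_trans (ltn_ord i)).
rewrite (bigD1 (Ordinal (nk : (n < k.+1)%N))) //= eqxx andbT big1 ?addr0.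
  rewrite -(eqn_add2r n) subnK //; case: eqP => [->|//].
  by rewrite ?mul1n.
move=> i; rewrite -val_eqE /= => /negPf->.
by rewrite andbF.
Qed.

Variables (A : Type) (rho : A -> V -> vpoly V).
Hypothesis rho0 : forall a, rho a 0 = 0.

Lemma vcoef_act_act a b v n m :
  vcoef m (vcoef n (act_act rho (lam3 K) a (mu3 K) b v)) =
  vcoef m (rho a (vcoef n (rho b v))).
Proof.
rewrite /act_act /vsubst !vcoef_sum.
rewrite -(@sum_msupp _ _ (fun n => vcoef m (rho a (vcoef n (rho b v))))
  (rho b v) n); last by move=> k ->; rewrite rho0 vcoef0.
apply: eq_bigr => k _; rewrite vcoef_at2.
rewrite -(@sum_msupp _ _ (fun m => vcoef m (rho a (vcoef k (rho b v))) *+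
  (k == n)) (rho a (vcoef k (rho b v))) m); last by move=> j ->; rewrite mul0rn.
apply: eq_bigr => j _.
rewrite mulrC coef_lamX_muX scaler_nat -mulrnA; congr (_ *+ _).
by rewrite mulnb andbC.
Qed.

Lemma vcoef_act_act_swap a b v n m :
  vcoef m (vcoef n (act_act rho (mu3 K) b (lam3 K) a v)) =
  vcoef n (rho b (vcoef m (rho a v))).
Proof.
rewrite /act_act /vsubst !vcoef_sum.
rewrite -(@sum_msupp _ _ (fun m => vcoef n (rho b (vcoef m (rho a v))))
  (rho a v) m); last by move=> k ->; rewrite rho0 vcoef0.
apply: eq_bigr => k _; rewrite vcoef_at2.
rewrite -(@sum_msupp _ _ (fun n => vcoef n (rho b (vcoef k (rho a v))) *+
  (k == m)) (rho b (vcoef k (rho a v))) n); last by move=> j ->; rewrite mul0rn.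
apply: eq_bigr => j _.
rewrite coef_lamX_muX scaler_nat -mulrnA; congr (_ *+ _).
by rewrite mulnb andbC.
Qed.

Lemma vcoef_at2_lamDmu (f : vpoly V) n m :
  vcoef m (vcoef n (at2 (lam3 K + mu3 K) f)) =
  vcoef (m + n) f *+ 'C(m + n, n).
Proof.
rewrite -[at2 _ _]scale1r vcoef_at2.
rewrite -(@sum_msupp _ _ (fun k => vcoef k f *+ 'C(m + n, n)) f (m + n));
  last by move=> k ->; rewrite mul0rn.
by apply: eq_bigr => k _; rewrite mul1r coef_lamDmu scaler_nat mulrnA mulrnAC.
Qed.

Lemma vcoef_lam_at2_lamDmu (f : vpoly V) n m :
  vcoef m (vcoef n (lam3 K *: at2 (lam3 K + mu3 K) f)) =
  if m is m'.+1 then vcoef (m' + n) f *+ 'C(m' + n, n) else 0.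
Proof.
rewrite vcoefCZ vcoefXZ; case: m => // m; exact: vcoef_at2_lamDmu.
Qed.

(** Brackets of generators have degree at most one in lambda, so two terms suffice. *)
Lemma vcoef_sum2_lamDmu (F : nat -> vpoly V) n m :
  vcoef m (vcoef n
    (\sum_(k < 2) lam3 K ^+ k *: at2 (lam3 K + mu3 K) (F k))) =
  vcoef (m + n) (F 0%N) *+ 'C(m + n, n) +
  if m is m'.+1 then vcoef (m' + n) (F 1%N) *+ 'C(m' + n, n) else 0.
Proof.
rewrite big_ord_recl big_ord1 expr0 scale1r expr1 vcoefD vcoefD.
by rewrite vcoef_at2_lamDmu vcoef_lam_at2_lamDmu.
Qed.

Lemma vcoef_subE (F G H : vpoly (vpoly V)) n m : F - G = H ->
  vcoef m (vcoef n F) - vcoef m (vcoef n G) = vcoef m (vcoef n H).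
Proof. by move=> <-; rewrite !vcoefD !vcoefN. Qed.

End At2.

(** * Commutators of the coefficient operators of L, M and Y *)

Section Commutators.
Variables (K : numFieldType) (V : confModule (SV K)).
Local Notation P1 := {poly K}.
Implicit Types (v w : V) (i j : 'I_3) (n m k : nat) (c : K).

Definition sv_gen i : SV K := delta_mx 0 i.

(* With no factor n!, unlike the usual n-th product. *)
Definition op i n v : V := vcoef n (lact (sv_gen i) v).

Local Notation l_ := (op iL).
Local Notation m_ := (op iM).
Local Notation y_ := (op iY).

Lemma lact0r (a : SV K) : lact a (0 : V) = 0.
Proof. by apply: (addrI (lact a 0)); rewrite -lactDr !addr0. Qed.

Lemma lact0l v : lact (0 : SV K) v = 0.
Proof. by apply: (addrI (lact 0 v)); rewrite -lactDl !addr0. Qed.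

Lemma lact_polyl (p : P1) (a : SV K) v :
  lact (p *: a) v = peval (@polyC P1 \o @polyC K) (- lam2 K) p *: lact a v.
Proof.
elim/poly_ind: p a => [|p c IH] a.
  by rewrite scale0r lact0l rmorph0 scale0r.
rewrite scalerDl lactDl -scalerA IH lact_dl lactZl scalerA rmorphD rmorphM /=.
by rewrite pevalC pevalX scalerDl.
Qed.

Lemma lact_polyr (p : P1) (a : SV K) v :
  lact a (p *: v) =
  peval (@polyC P1 \o @polyC K) (d2 K + lam2 K) p *: lact a v.
Proof.
elim/poly_ind: p v => [|p c IH] v.
  by rewrite scale0r lact0r rmorph0 scale0r.
rewrite scalerDl lactDr -scalerA IH lact_dr lactZr scalerA rmorphD rmorphM /=.
by rewrite pevalC pevalX scalerDl.
Qed.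

Lemma opD i n v w : op i n (v + w) = op i n v + op i n w.
Proof. by rewrite /op lactDr vcoefD. Qed.

Lemma op0 i n : op i n 0 = 0.
Proof. by rewrite /op lact0r vcoef0. Qed.

Lemma opZ i n c v : op i n (c%:P *: v) = c%:P *: op i n v.
Proof. by rewrite /op lactZr vcoefCZ. Qed.

Lemma opX i n v :
  op i n ('X *: v) = 'X *: op i n v + if n is n'.+1 then op i n' v else 0.
Proof. by rewrite /op lact_dr scalerDl vcoefD vcoefCZ vcoefXZ. Qed.

Let brE i j : lbr (sv_gen i) (sv_gen j) = SVgen K i j.
Proof. exact: SVbr_gen. Qed.

Lemma op_commE i j n m v :
  op i m (op j n v) - op j n (op i m v) = vcoef m (vcoef n
    (br_act (@lbr K (SV K)) (@lact K (SV K) V) (lam3 K) (lam3 K + mu3 K)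
      (sv_gen i) (sv_gen j) v)).
Proof.
apply: etrans (vcoef_subE n m (lact_br (sv_gen i) (sv_gen j) v)).
congr (_ - _); first exact: (esym (vcoef_act_act lact0r _ _ _ _ _)).
exact: (esym (vcoef_act_act_swap lact0r _ _ _ _ _)).
Qed.

Lemma op_comm0 i j : SVgen K i j = 0 ->
  forall n m v, op i m (op j n v) = op j n (op i m v).
Proof.
move=> ij0 n m v; apply/eqP; rewrite -subr_eq0 op_commE; apply/eqP.
by rewrite /br_act brE ij0 /vsubst msupp0 big_seq_fset0 !vcoef0.
Qed.

(** In the bracket d acts as -(lambda + mu), so the commutator is (q lambda - p (lambda + mu))
    c_{lambda+mu} v, with c the generator [l]; take the coefficient of lambda^m mu^n. The truncation
    in [.-1] is harmless: at m = n = 0 the factor is 0. *)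
Lemma op_comm i j l (p q : K) :
  SVgen K i j = (p%:P%:P * d2 K + q%:P%:P * lam2 K) *: vconst (sv_gen l) ->
  forall n m v, op i m (op j n v) - op j n (op i m v) =
    (q *+ (if m is m'.+1 then 'C(m' + n, n) else 0%N)
       - p *+ (if (m + n)%N is _.+1 then 'C(m + n, n) else 0%N))%:P *:
      op l (m + n).-1 v.
Proof.
move=> ijE n m v; rewrite op_commE.
rewrite /br_act brE ijE /vsubst.
set f := _ *: vconst _.
have fE (k : nat) : vcoef k f = (if k is 0%N then p%:P * 'X else
    if k is 1%N then q%:P else 0) *: sv_gen l.
  rewrite /f vcoefZ_const coefD /d2 /lam2 -polyCM coefC coefMX coefC.
  by case: k => [|[|k]] /=; rewrite ?addr0 ?add0r.
rewrite (@sum_msupp_bound _ _ _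
  (fun k => lam3 K ^+ k *: at2 (lam3 K + mu3 K) (lact (vcoef k f) v)) f 2).
- rewrite (vcoef_sum2_lamDmu (fun k => lact (vcoef k f) v)) !fE.
  rewrite -scalerA !lactZl lact_dl !vcoefCZ scaleNr vcoefN vcoefXZ.
  rewrite rmorphB !rmorphMn scalerBl -!scalerMnl /op.
  case: m => [|m]; last first.
    by rewrite addSn vcoefCZ /= scalerN mulNrn addrC.
  rewrite /= mulr0n sub0r addr0 add0n; case: n => [|n].
    by rewrite !(oppr0, scaler0, mulr0n, mul0rn, scale0r).
  by rewrite scalerN mulNrn.
- move=> k ->; rewrite lact0l.
  by rewrite /at2 /vsubst msupp0 big_seq_fset0 scaler0.
- by case=> [|[|k]] // _; rewrite fE scale0r.
Qed.


(** The conformal weights q of L, M and Y, as in [L_lambda a] = (d + q lambda) a. *)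
Definition sv_q i : K := nth 0 [:: 2; 1; 3 / 2] i.

Lemma SVgen_L i :
  SVgen K iL i =
  (1%:P%:P * d2 K + (sv_q i)%:P%:P * lam2 K) *: vconst (sv_gen i).
Proof.
rewrite !polyC1 mul1r /sv_q.
by case: (ord3P i) => ->; rewrite /SVgen /= ?polyC_natr ?polyC1 ?mul1r.
Qed.

Lemma SVgen_YY :
  SVgen K iY iY =
  (1%:P%:P * d2 K + 2%:P%:P * lam2 K) *: vconst (sv_gen iM).
Proof. by rewrite !polyC1 mul1r !polyC_natr. Qed.

(** As M has weight 1, the two terms of its commutator with L cancel at index 0. *)
Lemma op_central i n v : m_ 0 (op i n v) = op i n (m_ 0 v).
Proof.
case: (ord3P i) => ->; try exact: op_comm0.
apply/eqP; rewrite eq_sym -subr_eq0 (op_comm (SVgen_L iM)) /sv_q /=.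
by case: n => [|n]; rewrite ?addn0 ?bin0 subrr scale0r.
Qed.

(** The correction is the one that [opX] gives for d, so L_0 - d commutes with every operator. *)
Lemma l0_comm i n v :
  op i n (l_ 0 v) = l_ 0 (op i n v) + if n is n'.+1 then op i n' v else 0.
Proof.
apply: (addrI (- op i n (l_ 0 v))); rewrite addNr addrA [- _ + _]addrC.
rewrite (op_comm (SVgen_L i)) mulr0n sub0r add0n.
case: n => [|n]; first by rewrite mulr0n oppr0 scale0r addr0.
by rewrite binn mulr1n polyCN scaleN1r addNr.
Qed.

(** The shift of L_1-eigenvalues under [op i n]: 1 - n for L, -n for M, 1/2 - n for Y. *)
Definition wt i n : K := sv_q i - 1 - n%:R.

Lemma l1_comm i n v :
  l_ 1 (op i n v) = op i n (l_ 1 v) + (wt i n)%:P *: op i n v.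
Proof.
apply/eqP; rewrite addrC -subr_eq (op_comm (SVgen_L i)) /=.
by rewrite add0n add1n binn binSn /wt mulr1n mulrS opprD addrA.
Qed.

Lemma l_y0_comm n v :
  l_ n.+1 (y_ 0 v) = y_ 0 (l_ n.+1 v) + (1 / 2)%:P *: y_ n v.
Proof.
apply/eqP; rewrite addrC -subr_eq (op_comm (SVgen_L iY)) addn0 /= /sv_q /=.
have E : 3 / 2 - 1 = 1 / 2 :> K by field.
by rewrite !bin0 !mulr1n E !addn0.
Qed.

Lemma y_y0_comm n v :
  y_ n.+1 (y_ 0 v) = y_ 0 (y_ n.+1 v) + m_ n v.
Proof.
apply/eqP; rewrite addrC -subr_eq (op_comm SVgen_YY) addn0 /=.
have E : 2 - 1 = 1 :> K by ring.
by rewrite !bin0 !mulr1n E addn0 scale1r.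
Qed.

Lemma m_y_comm n k v : m_ n (y_ k v) = y_ k (m_ n v).
Proof. exact: op_comm0. Qed.

End Commutators.

(** * Finite dimensional K-subspaces of a K[d]-module *)

Section ScalarLinear.
Variables (K : fieldType) (V : lmodType {poly K}).
Implicit Types (U : V -> Prop) (E : seq V) (T : V -> V) (v : V).

Definition scalar_linear T :=
  (forall u v, T (u + v) = T u + T v) /\
  (forall (c : K) v, T (c%:P *: v) = c%:P *: T v).

Definition scalar_closed U :=
  [/\ U 0, forall u v, U u -> U v -> U (u + v)
    & forall (c : K) v, U v -> U (c%:P *: v)].

Definition in_span E v :=
  exists c : 'I_(size E) -> K, v = \sum_(k < size E) (c k)%:P *: E`_k.

(** Dimension less than [D], stated without a basis; only the first [D] terms of [w] count. *)
Definition fin_dim U := exists D, forall w : nat -> V, (forall n, U (w n)) ->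
  exists2 c : 'I_D -> K, (exists i, c i != 0) &
    \sum_(i < D) (c i)%:P *: w i = 0.

Lemma scalar_linear0 T : scalar_linear T -> T 0 = 0.
Proof. by case=> TD _; apply: (addrI (T 0)); rewrite -TD !addr0. Qed.

Lemma scalar_linear_sum T n (c : 'I_n -> K) (w : 'I_n -> V) :
  scalar_linear T ->
  T (\sum_(i < n) (c i)%:P *: w i) = \sum_(i < n) (c i)%:P *: T (w i).
Proof.
move=> Tl; have [TD TZ] := Tl; rewrite (big_morph T TD (scalar_linear0 Tl)).
by apply: eq_bigr => i _; rewrite TZ.
Qed.

Lemma scalar_closed_sum U n (c : 'I_n -> K) (w : 'I_n -> V) :
  scalar_closed U -> (forall i, U (w i)) -> U (\sum_(i < n) (c i)%:P *: w i).
Proof. by move=> [U0 UD UZ] Uw; elim/big_ind: _ => // i _; apply: UZ. Qed.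

Lemma in_span_closed E : scalar_closed (in_span E).
Proof.
split=> [|u v [c ->] [d ->]|a v [c ->]].
- by exists (fun=> 0); rewrite big1 // => i _; rewrite scale0r.
- exists (fun i => c i + d i); rewrite -big_split; apply: eq_bigr => i _.
  by rewrite polyCD scalerDl.
- exists (fun i => a * c i); rewrite scaler_sumr; apply: eq_bigr => i _.
  by rewrite polyCM scalerA.
Qed.

Lemma mem_in_span E v : v \in E -> in_span E v.
Proof.
move=> vE; have vi : (index v E < size E)%N by rewrite index_mem.
exists (fun i => (i == Ordinal vi)%:R).
rewrite (bigD1 (Ordinal vi)) //= eqxx scale1r nth_index // big1 ?addr0 // => i.
by move=> /negPf->; rewrite scale0r.
Qed.

(** Together the maps [b i] embed [U] in a product of [#|I|] copies of the span of [E]. *)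
Lemma fin_dim_coords (I : finType) (b : I -> V -> V) E U :
  (forall i, scalar_linear (b i)) -> scalar_closed U ->
  (forall i v, U v -> in_span E (b i v)) ->
  (forall v, U v -> (forall i, b i v = 0) -> v = 0) -> fin_dim U.
Proof.
move=> bl Uc bE bI; exists (#|I| * size E).+1 => w Uw.
have /choice[C CE] : forall x : nat * I, exists c : 'I_(size E) -> K,
    b x.2 (w x.1) = \sum_(k < size E) (c k)%:P *: E`_k.
  by move=> [n i]; apply: bE.
pose M (n : 'I_(#|I| * size E).+1) : 'M[K]_(#|I|, size E) :=
  \matrix_(i, k) C (nat_of_ord n, enum_val i) k.
(* One row of flattened coordinates per vector; there are more rows than columns, so the rows are
   dependent. *)
pose A := \matrix_n mxvec (M n).
have /rowV0Pn[x] : kermx A != 0.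
  rewrite -mxrank_eq0 mxrank_ker subn_eq0 -ltnNge.
  exact: leq_ltn_trans (rank_leq_col A) _.
rewrite sub_kermx => /eqP xA /eqP x0.
have {}xA : \sum_n x 0 n *: M n = 0.
  apply: (can_inj mxvecK); rewrite linear_sum linear0 -[RHS]xA mulmx_sum_row.
  by apply: eq_bigr => n _; rewrite linearZ rowK.
exists (x 0).
  apply: contrapT => x_all0; apply: x0; apply/rowP => n; rewrite mxE.
  apply/eqP; rewrite -[_ == _]negbK; apply/negP => xn.
  by apply: x_all0; exists n.
apply: bI => [|i]; first exact: scalar_closed_sum.
rewrite scalar_linear_sum //.
under eq_bigr => n _ do rewrite (CE (nat_of_ord n, i)) scaler_sumr.
rewrite exchange_big big1 //= => k _.
under eq_bigr => n _ do rewrite scalerA -polyCM.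
rewrite -scaler_suml -rmorph_sum /=.
have -> : \sum_n x 0 n * C (nat_of_ord n, i) k =
    (\sum_n x 0 n *: M n) (enum_rank i) k.
  by rewrite summxE; apply: eq_bigr => n _; rewrite !mxE enum_rankK.
by rewrite xA mxE scale0r.
Qed.

(** Eigenvectors with distinct eigenvalues are independent, so infinitely many nonzero ones do not
    fit in [U]. *)
Lemma fin_dim_eigenvalues U T (w : nat -> V) (s : nat -> K) :
  fin_dim U -> scalar_linear T -> injective s ->
  (forall n, U (w n)) -> (forall n, T (w n) = (s n)%:P *: w n) ->
  exists n, w n = 0.
Proof.
move=> [D Ufin] Tl sI Uw Tw; have [c [i ci0] c0] := Ufin w Uw.
(* Applying p(T) to the relation multiplies its j-th term by p(s_j). *)
exists i; have pc (p : {poly K}) : \sum_(j < D) (c j * p.[s j])%:P *: w j = 0.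
  elim/poly_ind: p => [|p a IH].
    by rewrite big1 // => j _; rewrite horner0 mulr0 scale0r.
  transitivity (T (\sum_(j < D) (c j * p.[s j])%:P *: w j) +
                a%:P *: \sum_(j < D) (c j)%:P *: w j).
    rewrite scalar_linear_sum // scaler_sumr -big_split /=.
    apply: eq_bigr => j _; rewrite Tw !scalerA -!polyCM -scalerDl -polyCD
      hornerMXaddC.
    by congr (_%:P *: _); ring.
  by rewrite IH c0 scaler0 addr0 scalar_linear0.
(* Among the [s j] with j < D only [s i] is not a root, which isolates the term of [w i]. *)
pose q := \prod_(j < D | j != i) ('X - (s j)%:P).
have q0 j : j != i -> q.[s j] = 0.
  move=> ji; rewrite horner_prod (bigD1 j) //=.
  by rewrite hornerXsubC subrr mul0r.
have := pc q; rewrite (bigD1 i) //= big1 ?addr0 => [|j ji]; last first.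
  by rewrite q0 // mulr0 scale0r.
set r := c i * _; have r0 : r != 0.
  rewrite mulf_neq0 // horner_prod; apply/prodf_neq0 => j ji.
  by rewrite hornerXsubC subr_eq0 (inj_eq sI) eq_sym.
move=> /(congr1 (fun v => r^-1%:P *: v)).
by rewrite scalerA -polyCM mulVf // scale1r scaler0.
Qed.

End ScalarLinear.

Section Eigenvector.
Variables (K : closedFieldType) (V : lmodType {poly K}).
Implicit Types (U : V -> Prop) (T : V -> V).

(** Some nonzero p has p(T) v = 0. Split off a root r of p: either (T - r) v = 0, or (T - r) v is a
    nonzero vector of [U] killed by the cofactor, which has lower degree. *)
Lemma fin_dim_eigenvector U T v :
  fin_dim U -> scalar_closed U -> scalar_linear T ->
  (forall u, U u -> U (T u)) -> U v -> v <> 0 ->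
  exists s u, [/\ U u, u <> 0 & T u = s%:P *: u].
Proof.
move=> [D Ufin] [U0 UD UZ] Tl TU Uv v0; have [TD TZ] := Tl.
have UT n : U (iter n T v) by elim: n => // n; apply: TU.
have [c [i ci0] cT] := Ufin _ UT.
have : exists2 p : {poly K}, p != 0 & exists n, (size p <= n)%N /\
    \sum_(i < n) (p`_i)%:P *: iter i T v = 0.
  exists (\poly_(i < D) (if insub i is Some j then c j else 0)).
    apply/eqP => /polyP/(_ i); rewrite coef_poly ltn_ord valK coef0.
    exact/eqP.
  exists D; split; first exact: size_poly.
  rewrite -[RHS]cT; apply: eq_bigr => j _.
  by rewrite coef_poly ltn_ord valK.
move=> [p p0 [n [pn pT]]]; elim: n p v Uv v0 p0 pn pT {c i ci0 cT UT} =>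
    [|n IH] p v Uv v0 p0 pn pT.
  by move: pn; rewrite leqn0 size_poly_eq0 (negPf p0).
have [/eqP/size_poly1P[a a0 pa]|/closed_rootP[r]] := eqVneq (size p) 1%N.
  case: v0; move: pT; rewrite pa big_ord_recl coefC big1 ?addr0 => [|i _].
    move=> /(congr1 (fun v => a^-1%:P *: v)).
    by rewrite scalerA -polyCM mulVf // scale1r scaler0.
  by rewrite coefC scale0r.
move=> /factor_theorem[q pq].
have q0 : q != 0 by apply: contraNneq p0 => q0; rewrite pq q0 mul0r.
pose v' := T v - r%:P *: v.
have [v'0|v'0] := pselect (v' = 0).
  by exists r, v; split=> //; apply/eqP; rewrite -subr_eq0 -/v' v'0.
have qn : (size q <= n)%N.
  by move: pn; rewrite pq size_Mmonic ?monicXsubC // size_XsubC addn2.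
have Uv' : U v'.
  by apply: UD; [exact: TU|rewrite -scaleNr -polyCN; exact: UZ].
apply: (IH q v') => //.
rewrite -[RHS]pT pq.
have Titer i : iter i T v' = iter i.+1 T v - r%:P *: iter i T v.
  elim: i => // i /= ->; rewrite TD; congr (_ + _).
  by rewrite -!scaleNr -!polyCN TZ.
under eq_bigr => i _ do rewrite Titer scalerBr scalerA mulrC -polyCM.
rewrite sumrB; under [RHS]eq_bigr => i _ do
  rewrite mulrBr coefB coefMC polyCB scalerBl.
rewrite sumrB big_ord_recl coefMX scale0r add0r; congr (_ - _).
  by apply: eq_bigr => i _; rewrite coefMX.
rewrite big_ord_recr /= nth_default // mul0r scale0r addr0.
by apply: eq_bigr => i _; rewrite mulrC.
Qed.

End Eigenvector.

(** * Expansion in powers of x = d + lambda *)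

Section Reexpansion.
Variables (K : fieldType) (V : lmodType {poly K}).
Implicit Types (f g : vpoly V) (m n : nat).

(** The coefficient of x^m in lambda^n = (x - d)^n. *)
Let g_ n m : {poly K} := 'C(n, m)%:R * (- 'X) ^+ (n - m).

(* The coefficient of x^m when f in V[lambda] is rewritten in terms of
   x = d + lambda; multiplication by d + lambda becomes a shift. *)
Definition xcoef m f : V := \sum_(n <- msupp f) g_ n m *: vcoef n f.

Lemma xcoefE m f B : (forall n, (B <= n)%N -> vcoef n f = 0) ->
  xcoef m f = \sum_(n < B) g_ n m *: vcoef n f.
Proof. by apply: sum_msupp_bound => n ->; rewrite scaler0. Qed.

Lemma xcoefD m f g : xcoef m (f + g) = xcoef m f + xcoef m g.
Proof.
have [[B1 fB] [B2 gB]] := (vpoly_bound f, vpoly_bound g).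
have {}fB n : (maxn B1 B2 <= n)%N -> vcoef n f = 0.
  by rewrite geq_max => /andP[/fB].
have {}gB n : (maxn B1 B2 <= n)%N -> vcoef n g = 0.
  by rewrite geq_max => /andP[_ /gB].
rewrite (xcoefE m fB) (xcoefE m gB) (@xcoefE m (f + g) (maxn B1 B2)).
  by rewrite -big_split; apply: eq_bigr => n _; rewrite vcoefD scalerDr.
by move=> n Bn; rewrite vcoefD fB // gB // addr0.
Qed.

Lemma xcoefCZ m (p : {poly K}) f :
  xcoef m (p%:P *: f) = p *: xcoef m f.
Proof.
have [B fB] := vpoly_bound f; rewrite (xcoefE m fB) (@xcoefE m (p%:P *: f) B).
  rewrite [RHS]scaler_sumr; apply: eq_bigr => n _.
  by rewrite vcoefCZ !scalerA mulrC.
by move=> n Bn; rewrite vcoefCZ fB // scaler0.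
Qed.

Lemma xcoef_high m f : (forall n, (m <= n)%N -> vcoef n f = 0) -> xcoef m f = 0.
Proof.
move=> fm; rewrite (xcoefE m fm) big1 // => n _.
by rewrite /g_ bin_small // mul0r scale0r.
Qed.

(** The change of variable is unitriangular: the top coefficients in lambda and in x agree. *)
Lemma xcoef_inj f : (forall m, xcoef m f = 0) -> f = 0.
Proof.
move=> xf0; have [B] := vpoly_bound f; elim: B => [|B IH] fB.
  by apply: vpolyP => n; rewrite fB // vcoef0.
apply: IH => n; rewrite leq_eqVlt => /predU1P[<-|/fB //].
have := xf0 B; rewrite (xcoefE B fB) big_ord_recr /= big1 ?add0r => [|i _].
  by rewrite /g_ binn subnn mulr1 scale1r.
by rewrite /g_ bin_small // mul0r scale0r.
Qed.

Lemma xcoef_shift m f : xcoef m ((d2 K + lam2 K) *: f) =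
  if m is m'.+1 then xcoef m' f else 0.
Proof.
have [B fB] := vpoly_bound f.
have fE n : vcoef n ((d2 K + lam2 K) *: f) =
    'X *: vcoef n f + if n is n'.+1 then vcoef n' f else 0.
  by rewrite scalerDl vcoefD vcoefCZ vcoefXZ.
rewrite (@xcoefE m _ B.+1) => [|n Bn]; last first.
  rewrite fE fB ?(ltnW Bn) // scaler0 add0r.
  by case: n Bn => // n; apply: fB.
under eq_bigr => n _ do rewrite fE scalerDr.
rewrite big_split /= big_ord_recr /= fB // !scaler0 addr0.
rewrite [X in _ + X]big_ord_recl /= scaler0 add0r -big_split /=.
under eq_bigr => n _ do rewrite scalerA -scalerDl.
case: m => [|m].
  rewrite big1 // => n _; rewrite /g_ !bin0 !subn0 !mul1r exprS mulNr mulrC.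
  by rewrite subrr scale0r.
rewrite (xcoefE m fB); apply: eq_bigr => n _; congr (_ *: _).
(* Pascal's rule: one part is the shifted coefficient, the other cancels against the multiple of
   d. *)
rewrite /g_ /bump add1n binS subSS natrD mulrDl addrA -[RHS]add0r.
congr (_ + _); have [nm|mn] := leqP n m.
  by rewrite bin_small // !mul0r addr0.
by rewrite -(subnSK mn) exprS; ring.
Qed.

End Reexpansion.

(** * Finite dimensionality of the spaces V_N *)

Section Killed.
Variables (K : numFieldType) (V : confModule (SV K)).
Implicit Types (v w : V) (i : 'I_3) (n m N : nat) (c : K).

Definition killed N v := forall i n, (N <= n)%N -> op i n v = 0.

Lemma killed_closed N : scalar_closed (killed N).
Proof.
split=> [i n _|u v uN vN i n Nn|c v vN i n Nn]; first exact: op0.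
  by rewrite opD uN // vN // addr0.
by rewrite opZ vN // scaler0.
Qed.

Lemma killed_ex v : exists N, killed N v.
Proof.
have [N0 v0] := vpoly_bound (lact (sv_gen K (Ordinal (isT : 0 < 3)%N)) v).
have [N1 v1] := vpoly_bound (lact (sv_gen K (Ordinal (isT : 1 < 3)%N)) v).
have [N2 v2] := vpoly_bound (lact (sv_gen K (Ordinal (isT : 2 < 3)%N)) v).
exists (maxn N0 (maxn N1 N2)) => i n; rewrite !geq_max => /and3P[h0 h1 h2].
by case: (ord3P i) => ->; [exact: v0|exact: v1|exact: v2].
Qed.

Let b i m v : V := xcoef m (lact (sv_gen K i) v).

Let b_linear i m : scalar_linear (b i m).
Proof.
by split=> [u v|c v]; rewrite /b ?lactDr ?xcoefD // lactZr xcoefCZ.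
Qed.

Let bX i m v : b i m ('X *: v) = if m is m'.+1 then b i m' v else 0.
Proof. by rewrite /b lact_dr xcoef_shift. Qed.

(** Multiplication by d only shifts the index of [b], so the coefficients of the finitely many
    generators span all values, and these vanish for large index. *)
Let b_span : cm_finite V -> exists E, forall i m v, in_span E (b i m v).
Proof.
move=> [s sV].
have /choice[B bB] : forall x : 'I_3 * 'I_(size s), exists B,
    forall n, (B <= n)%N -> vcoef n (lact (sv_gen K x.1) s`_x.2) = 0.
  by move=> x; apply: vpoly_bound.
pose T : finType := (('I_3 * 'I_(size s)) * 'I_(\max_x B x))%type.
pose E := [seq b x.1.1 x.2 s`_(x.1.2) | x : T <- enum T].
have [E0 ED EZ] := in_span_closed E.
have bs i m (j : 'I_(size s)) : in_span E (b i m s`_j).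
  have [mB|Bm] := ltnP m (\max_x B x).
    apply: mem_in_span; apply/mapP; exists ((i, j), Ordinal mB) => //.
    by rewrite mem_enum.
  rewrite (_ : b i m _ = 0) //; apply: xcoef_high => n mn.
  apply: (bB (i, j)); apply: leq_trans mn; apply: leq_trans Bm.
  exact: leq_bigmax.
have bps (p : {poly K}) i m (j : 'I_(size s)) : in_span E (b i m (p *: s`_j)).
  elim/poly_ind: p m => [|p c IH] m.
    by rewrite scale0r scalar_linear0.
  have [bD bZ] := b_linear i m.
  rewrite scalerDl bD bZ mulrC -scalerA bX; apply: ED; last exact: EZ.
  by case: m {bD bZ} => //.
exists E => i m v; have [c ->] := sV v.
have [bD bZ] := b_linear i m.
rewrite (big_morph (b i m) bD (scalar_linear0 (b_linear i m))).
by elim/big_ind: _ => //.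
Qed.

(** On V_N the coefficients in x vanish from index N on, so the [b i m] with m < N determine the
    whole action on v, hence v itself. *)
Lemma killed_fin_dim N : cm_finite V ->
  (forall v, (forall i n, op i n v = 0) -> v = 0) -> fin_dim (killed N).
Proof.
move=> /b_span[E bE] V0.
apply: (@fin_dim_coords _ _ ('I_3 * 'I_N)%type (fun x => b x.1 x.2) E) => //.
- exact: killed_closed.
- move=> v vN bv; apply: V0 => i n.
  rewrite /op; suff -> : lact (sv_gen K i) v = 0 by rewrite vcoef0.
  apply: xcoef_inj => m; have [mN|Nm] := ltnP m N.
    exact: (bv (i, Ordinal mN)).
  by apply: xcoef_high => k mk; apply: vN; apply: leq_trans mk.
Qed.

End Killed.

Local Notation l_ := (op iL).
Local Notation m_ := (op iM).
Local Notation y_ := (op iY).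

(** * Irreducible modules *)

Section Submodules.
Variables (K : numFieldType) (V : confModule (SV K)).
Implicit Types (v w : V) (i j : 'I_3) (n m N : nat) (c : K) (U : V -> Prop).

Lemma lact_gens (a : SV K) v :
  lact a v = \sum_(i < 3) peval (@polyC {poly K} \o @polyC K) (- lam2 K)
    ((a : 'rV_3) 0 i) *: lact (sv_gen K i) v.
Proof.
rewrite {1}[a](row_sum_delta (a : 'rV_3)).
rewrite (big_morph (fun x : SV K => lact x v)
  (fun x y => lactDl x y v) (lact0l v)).
by apply: eq_bigr => i _; rewrite lact_polyl.
Qed.

Lemma gen_submodule U : scalar_closed U -> (forall v, U v -> U ('X *: v)) ->
  (forall i n v, U v -> U (op i n v)) -> cm_submodule U.
Proof.
move=> [U0 UD UZ] UX Uop.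
have Up (p : {poly K}) u : U u -> U (p *: u).
  elim/poly_ind: p u => [|p c IH] u Uu; first by rewrite scale0r.
  by rewrite scalerDl -scalerA; apply: UD; [apply/IH/UX|apply: UZ].
split=> // a u Uu n; rewrite lact_gens vcoef_sum.
elim/big_ind: _ => // i _; rewrite vcoefZ; elim/big_ind: _ => // k _.
exact/Up/Uop.
Qed.

Lemma submodule_full U v :
  cm_irreducible V -> cm_submodule U -> U v -> v <> 0 -> forall w, U w.
Proof. by move=> [_ /(_ U) irr] /irr[UE|//] Uv /UE. Qed.

(** The vectors killed by all operators form a submodule; if it were nonzero, V would be trivial. *)
Lemma op_eq0 v : cm_irreducible V -> ~ cm_trivial V ->
  (forall i n, op i n v = 0) -> v = 0.
Proof.
move=> irr ntriv v0; apply: contrapT => vn0; apply: ntriv => a w.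
have U w' : forall i n, op i n w' = 0.
  apply: (@submodule_full (fun w' => forall i n, op i n w' = 0) v) => //.
  apply: gen_submodule.
  - split=> [i n|u1 u2 H1 H2 i n|c u H i n]; first exact: op0.
      by rewrite opD H1 H2 addr0.
    by rewrite opZ H scaler0.
  - by move=> u H i [|n]; rewrite opX !H scaler0 addr0.
  - by move=> j m u H i n; rewrite H op0.
rewrite lact_gens big1 // => i _.
rewrite (_ : lact _ _ = 0) ?scaler0 //; apply: vpolyP => n.
by rewrite vcoef0; apply: U.
Qed.

Lemma l_comm i m n v : exists c,
  l_ m (op i n v) = op i n (l_ m v) + c%:P *: op i (m + n).-1 v.
Proof.
eexists; apply/eqP; rewrite addrC -subr_eq; apply/eqP.
exact: (op_comm (SVgen_L K i)).
Qed.

Lemma y_comm m n v : exists c,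
  y_ m (y_ n v) = y_ n (y_ m v) + c%:P *: m_ (m + n).-1 v.
Proof.
eexists; apply/eqP; rewrite addrC -subr_eq; apply/eqP.
exact: (op_comm (SVgen_YY K)).
Qed.

Lemma l_comm_rev i m n v : exists c,
  op i n (l_ m v) = l_ m (op i n v) + c%:P *: op i (n + m).-1 v.
Proof.
have [c ->] := l_comm i m n v; exists (- c).
by rewrite polyCN scaleNr addnC addrK.
Qed.

Lemma comm_ex i j m n v : exists l c,
  op i m (op j n v) = op j n (op i m v) + c%:P *: op l (m + n).-1 v.
Proof.
have C i' j' : SVgen K i' j' = 0 -> exists l c,
    op i' m (op j' n v) = op j' n (op i' m v) + c%:P *: op l (m + n).-1 v.
  move=> ij; exists iL, 0; rewrite scale0r addr0; exact: op_comm0.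
case: (ord3P i) => ->; first by exists j; apply: l_comm.
  case: (ord3P j) => ->; first by exists iM; apply: l_comm_rev.
    exact: C.
  exact: C.
case: (ord3P j) => ->; first by exists iY; apply: l_comm_rev.
  exact: C.
by exists iM; apply: y_comm.
Qed.

(** A commutator lowers the sum of the indices by one, so index [n.+1] keeps it at k + n >= N, while
    index 0 could reach N - 1. *)
Lemma killed_op N i n v : killed N v -> killed N (op i n.+1 v).
Proof.
move=> vN j k Nk; have [l [c ->]] := comm_ex j i k n.+1 v.
rewrite vN // op0 add0r addnS /= vN ?scaler0 //.
exact: leq_trans Nk (leq_addr _ _).
Qed.

(** By [opX], (c - d) a_{n+1} v = a_n v; as a_n v = 0 for large n, one descends. *)
Lemma op_eigenvector_X v c :
  'X *: v = c%:P *: v -> forall i n, op i n v = 0.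
Proof.
move=> Xv i; have [N vN] := killed_ex v.
suff H k n : (N <= n + k)%N -> op i n v = 0.
  by move=> n; apply: (H N); apply: leq_addl.
elim: k n => [|k IH] n; first by rewrite addn0; apply: vN.
move=> Nnk; have := opX i n.+1 v; rewrite Xv opZ IH ?addSnnS // !scaler0 add0r.
by move=> <-.
Qed.

End Submodules.

(** * Scalar operators, lowest eigenvectors and a free generator *)

Section Classification.
Variables (K : numClosedFieldType) (V : confModule (SV K)).
Hypotheses (Vfin : cm_finite V) (Virr : cm_irreducible V).
Hypothesis Vnt : ~ cm_trivial V.
Implicit Types (v w u : V) (i j : 'I_3) (n m k N : nat) (c : K).

Let V0 v : (forall i n, op i n v = 0) -> v = 0.
Proof. exact: op_eq0. Qed.

Let kfin N : fin_dim (@killed K V N).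
Proof. exact: killed_fin_dim. Qed.

(** Schur's lemma: T has an eigenvector in some V_N, and its eigenspace in V is a submodule. *)
Lemma central_scalar (T : V -> V) :
  scalar_linear T -> (forall v, T ('X *: v) = 'X *: T v) ->
  (forall i n v, op i n (T v) = T (op i n v)) ->
  exists c, forall v, T v = c%:P *: v.
Proof.
move=> Tl TX Top; have [TD TZ] := Tl.
have [[v v0] _] := Virr; have [N vN] := killed_ex v.
have TK w : killed N w -> killed N (T w).
  by move=> wN i n Nn; rewrite Top wN // (scalar_linear0 Tl).
have [c [u [uN u0 Tu]]] :=
  fin_dim_eigenvector (kfin N) (@killed_closed _ V N) Tl TK vN v0.
exists c.
apply: (submodule_full (U := fun w => T w = c%:P *: w) (v := u)) => //.
apply: gen_submodule.
- split=> [|u1 u2 H1 H2|a w H]; first by rewrite (scalar_linear0 Tl) scaler0.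
    by rewrite TD H1 H2 scalerDr.
  by rewrite TZ H !scalerA mulrC.
- by move=> w H; rewrite TX H !scalerA mulrC.
- by move=> i n w H; rewrite -Top H opZ.
Qed.

Lemma l0_scalar : exists alpha, forall v, l_ 0 v = ('X + alpha%:P) *: v.
Proof.
have [|||alpha H] := @central_scalar (fun v => l_ 0 v - 'X *: v).
- split=> [v w|c v]; first by rewrite opD scalerDr opprD addrACA.
  by rewrite opZ scalerBr !scalerA mulrC.
- by move=> v; rewrite opX addr0 scalerBr.
- move=> i n v; rewrite -scaleN1r -polyC1 -polyCN opD opZ opX l0_comm.
  by rewrite polyCN scaleNr scale1r opprD addrACA subrr addr0.
by exists alpha => v; rewrite scalerDl -H addrC subrK.
Qed.

Lemma m0_scalar : exists beta : K, forall v, m_ 0 v = beta%:P *: v.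
Proof.
apply: central_scalar => [|v|i n v].
- by split=> [v w|c v]; [apply: opD|apply: opZ].
- by rewrite opX addr0.
- by rewrite op_central.
Qed.

(** Steps of 1/2 suffice, since the shifts [wt] are multiples of 1/2. Without a lowest eigenvalue,
    V_N would contain eigenvectors for infinitely many d - k/2. *)
Lemma lowest_eigenvector : exists N u delta,
  [/\ killed N u, u <> 0, l_ 1 u = delta%:P *: u &
    forall k w, (0 < k)%N -> killed N w ->
      l_ 1 w = (delta - k%:R / 2)%:P *: w -> w = 0].
Proof.
have [[v v0] _] := Virr; have [N vN] := killed_ex v.
have l1l : scalar_linear (l_ 1 : V -> V).
  by split=> [x y|c x]; [apply: opD|apply: opZ].
have [d [u [uN u0 lu]]] := fin_dim_eigenvector (kfin N)
  (@killed_closed _ V N) l1l (fun w => @killed_op K V N iL 0 w) vN v0.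
pose P k w := [/\ killed N w, w <> 0 & l_ 1 w = (d - k%:R / 2)%:P *: w].
have P0 : exists w, P 0%N w by exists u; split; rewrite // mul0r subr0.
have [[k [[w [wN w0 lw]] Pk]]|H] :=
    pselect (exists k, (exists w, P k w) /\
      forall k', (k < k')%N -> ~ exists w, P k' w).
  exists N, w, (d - k%:R / 2); split=> // k' w' k'0 w'N lw'.
  apply: contrapT => w'0; apply: (Pk (k + k')%N).
    by rewrite -[X in (X < _)%N]addn0 ltn_add2l.
  by exists w'; split=> //; rewrite natrD mulrDl opprD addrA.
exfalso.
(* [g] sends an occurring k to a larger one; elsewhere its value 0 is a dummy. *)
have /choice[g gP] k : exists k', (exists w, P k w) ->
    (k < k')%N /\ exists w, P k' w.
  have [Pk|nPk] := pselect (exists w, P k w); last by exists 0%N.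
  apply: contrapT => nk; apply: H; exists k; split=> // k' kk' Pk'.
  by apply: nk; exists k'.
pose f n := iter n g 0%N.
have Pf n : exists w, P (f n) w by elim: n => // n IH; have [] := gP _ IH.
have f_lt n : (f n < f n.+1)%N by have [] := gP _ (Pf n).
have f_inj : injective f.
  apply: incn_inj; apply: leq_mono; exact: (homo_ltn ltn_trans).
have /choice[W WP] := Pf.
have [n Wn0] : exists n, W n = 0.
  apply: (fin_dim_eigenvalues (s := fun n => d - (f n)%:R / 2) (kfin N) l1l).
  - move=> n n' /addrI/oppr_inj/mulIf E; apply: f_inj; apply/eqP.
    by rewrite -(eqr_nat K) E // invr_neq0 // pnatr_eq0.
  - by move=> n; have [] := WP n.
  - by move=> n; have [] := WP n.
by have [] := WP n.
Qed.

(** These operators shift the eigenvalue by -(n+1), -(n+1/2) and -(n+1), below the lowest one;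
    having positive index, they preserve V_N. *)
Lemma lowest_vector : exists u delta,
  [/\ u <> 0, l_ 1 u = delta%:P *: u, forall n, l_ n.+2 u = 0,
      forall n, y_ n.+1 u = 0 & forall n, m_ n.+1 u = 0].
Proof.
have [N [u [delta [uN u0 lu low]]]] := lowest_eigenvector.
have H i n k : (0 < k)%N -> wt K i n.+1 = - (k%:R / 2) -> op i n.+1 u = 0.
  move=> k0 wk; apply: (low k) => //; first exact: killed_op.
  by rewrite l1_comm lu opZ -scalerDl -polyCD wk.
exists u, delta; split=> // n.
- apply: (H iL n.+1 n.+1.*2) => //; rewrite /wt /sv_q /= -muln2 natrM -!natr1.
  by field.
- apply: (H iY n n.*2.+1) => //; rewrite /wt /sv_q /= -muln2 -!natr1 natrM.
  by field.
- apply: (H iM n n.+1.*2) => //; rewrite /wt /sv_q /= -muln2 natrM -!natr1.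
  by field.
Qed.

(** The joint kernel of the M_n is a submodule, as commutators of L with M are multiples of M and Y
    commutes with M. *)
Lemma m_eq0 v u : (forall n, m_ n u = 0) -> u <> 0 -> forall n, m_ n v = 0.
Proof.
move=> mu u0; apply: (submodule_full (U := fun w => forall n, m_ n w = 0)
  (v := u)) => //; apply: gen_submodule.
- split=> [n|w w' H H' n|c w H n]; first exact: op0.
    by rewrite opD H H' addr0.
  by rewrite opZ H scaler0.
- by move=> w H [|n]; rewrite opX !H scaler0 addr0.
- move=> i k w H n; case: (ord3P i) => ->.
  + by have [c ->] := l_comm_rev iM k n w; rewrite !H op0 scaler0 addr0.
  + by rewrite !H op0.
  + by rewrite m_y_comm H op0.
Qed.

Lemma y_eq0 v u : (forall w n, m_ n w = 0) -> (forall n, y_ n u = 0) ->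
  u <> 0 -> forall n, y_ n v = 0.
Proof.
move=> m0 yu u0; apply: (submodule_full (U := fun w => forall n, y_ n w = 0)
  (v := u)) => //; apply: gen_submodule.
- split=> [n|w w' H H' n|c w H n]; first exact: op0.
    by rewrite opD H H' addr0.
  by rewrite opZ H scaler0.
- by move=> w H [|n]; rewrite opX !H scaler0 addr0.
- move=> i k w H n; case: (ord3P i) => ->.
  + by have [c ->] := l_comm_rev iY k n w; rewrite !H op0 scaler0 addr0.
  + by rewrite m0 op0.
  + by rewrite !H op0.
Qed.

Lemma vir_vector : exists u delta,
  [/\ u <> 0, l_ 1 u = delta%:P *: u, forall n, l_ n.+2 u = 0,
      forall v n, y_ n v = 0 & forall v n, m_ n v = 0].
Proof.
have [u [delta [u0 l1u lu yu mu]]] := lowest_vector.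
have [beta m0E] := m0_scalar.
pose w k : V := iter k (y_ 0) u.
have mw k n : m_ n.+1 (w k) = 0.
  by elim: k => [|k IH] //=; rewrite m_y_comm IH op0.
have yw k n : y_ n.+2 (w k) = 0.
  by elim: k => [|k IH] //=; rewrite y_y0_comm IH op0 mw addr0.
(* A Heisenberg relation, from [Y_1, Y_0] = M_0 = beta. At k = 0 the coefficient is 0, so [k.-1] is
   harmless. *)
have y1w k : y_ 1 (w k) = (k%:R * beta)%:P *: w k.-1.
  elim: k => [|k IH] /=; first by rewrite yu mul0r scale0r.
  rewrite y_y0_comm IH opZ m0E -natr1 mulrDl mul1r polyCD scalerDl.
  by case: k {IH} => [|k] //=; rewrite !mul0r !scale0r.
(* The index starts at 3: [L_{n+3}, Y_0] is a multiple of Y_{n+2}, which vanishes here, while Y_1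
   need not. *)
have lw k n : l_ n.+3 (w k) = 0.
  by elim: k => [|k IH] //=; rewrite l_y0_comm IH op0 yw scaler0 addr0.
have l1w k : l_ 1 (w k) = (delta + k%:R / 2)%:P *: w k.
  elim: k => [|k IH] /=; first by rewrite mul0r addr0.
  rewrite l1_comm IH opZ -scalerDl -polyCD /wt /sv_q /= -natr1.
  by congr (_%:P *: _); field.
have [k0 wk0] : exists k, w k = 0.
  apply: (fin_dim_eigenvalues (U := @killed K V 3) (T := l_ 1)
    (s := fun k => delta + k%:R / 2)) => //.
  - by split=> [x y|c x]; [apply: opD|apply: opZ].
  - move=> n n' /addrI/mulIf E; apply/eqP.
    by rewrite -(eqr_nat K) E // invr_neq0 // pnatr_eq0.
  - move=> k i [|[|[|n]]] // _; case: (ord3P i) => ->;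
      [exact: lw|exact: mw|exact: yw].
have wkb : exists k, w k == 0 by exists k0; apply/eqP.
case: (ex_minnP wkb) => [[|k]] /eqP wk kmin; first by case: u0.
have wk' : w k <> 0 by move=> /eqP/kmin; rewrite ltnn.
(* Applying Y_1 to Y_0^(k+1) u = 0 gives (k+1) beta Y_0^k u = 0. *)
have beta0 : beta = 0.
  have := y1w k.+1; rewrite wk op0 /= => /esym/(congr1 (fun v =>
    (k.+1%:R * beta)^-1%:P *: v)); rewrite scaler0 scalerA -polyCM.
  have [//|b0] := eqVneq beta 0.
  by rewrite mulVf ?scale1r // mulf_neq0 // pnatr_eq0.
have m0 v n : m_ n v = 0.
  apply: (@m_eq0 v u) => // -[|k'] //.
  by rewrite m0E beta0 scale0r.
(* The vector killed by all Y_n is Y_0^k u: Y_0 kills it by the choice of k, Y_1 because beta =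
   0. *)
exists u, delta; split=> // v n; apply: (@y_eq0 v (w k)) => // -[|[|n']] //.
by rewrite y1w beta0 mulr0 scale0r.
Qed.

(** Split p into linear factors: a vector killed by d - r is killed by every operator, hence
    zero. *)
Lemma torsion_free (p : {poly K}) v : p *: v = 0 -> p != 0 -> v = 0.
Proof.
move: {2}(size p) (leqnn (size p)) => n.
elim: n p v => [|n IH] p v pn pv p0.
  by move: pn; rewrite leqn0 size_poly_eq0 (negPf p0).
have [/eqP/size_poly1P[a a0 pa]|/closed_rootP[r /factor_theorem[q pq]]] :=
    eqVneq (size p) 1%N.
  move: pv => /(congr1 (fun v => a^-1%:P *: v)).
  by rewrite pa scalerA -polyCM mulVf // scale1r scaler0.
have q0 : q != 0 by apply: contraNneq p0 => q0; rewrite pq q0 mul0r.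
apply: V0; apply: (@op_eigenvector_X _ _ v r); apply/eqP.
rewrite -subr_eq0 -scalerBl; apply/eqP; apply: (IH q) => //.
  by move: pn; rewrite pq size_Mmonic ?monicXsubC // size_XsubC addn2.
by rewrite scalerA -pq.
Qed.

(** [opX] expresses the action on d w through that on w, so stability of K[d] v is checked at v
    alone. *)
Lemma cyclic_submodule v :
  (forall i n, exists q : {poly K}, op i n v = q *: v) ->
  cm_submodule (fun w => exists q : {poly K}, w = q *: v).
Proof.
move=> vop; have [U0 UD UZ] : scalar_closed (fun w => exists q, w = q *: v).
  split=> [|w w' [q ->] [q' ->]|c w [q ->]]; first by exists 0; rewrite scale0r.
    by exists (q + q'); rewrite scalerDl.
  by exists (c%:P * q); rewrite scalerA.
have UX w : (exists q, w = q *: v) -> exists q, 'X *: w = q *: v.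
  by move=> [q ->]; exists ('X * q); rewrite scalerA.
apply: gen_submodule => // i n w [p ->].
elim/poly_ind: p n => [|p c IH] n; first by rewrite scale0r op0.
rewrite scalerDl mulrC -scalerA opD opX opZ.
apply: (UD); last by apply: UZ.
apply: (UD); first by apply/UX/IH.
by case: n.
Qed.

Lemma free_generator : exists u delta alpha,
  [/\ [/\ u <> 0, delta != 0 & forall v, exists p : {poly K}, v = p *: u],
      l_ 0 u = ('X + alpha%:P) *: u, l_ 1 u = delta%:P *: u,
      forall n, l_ n.+2 u = 0 &
      forall n, y_ n u = 0 /\ m_ n u = 0].
Proof.
have [u [delta [u0 l1u lu y0 m0]]] := vir_vector.
have [alpha l0E] := l0_scalar.
have gen v : v <> 0 -> (forall n, exists q : {poly K}, l_ n v = q *: v) ->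
    forall w, exists p : {poly K}, w = p *: v.
  move=> v0 vop; apply: (submodule_full (v := v)) => //; last first.
    by exists 1; rewrite scale1r.
  apply: cyclic_submodule => i n; case: (ord3P i) => -> //;
    by exists 0; rewrite ?y0 ?m0 scale0r.
exists u, delta, alpha; split=> //; split=> //; last first.
  apply: gen => // -[|[|n]]; first by exists ('X + alpha%:P).
    by exists delta%:P.
  by exists 0; rewrite lu scale0r.
(* If delta = 0, L_1 fixes (d + alpha) u and the higher L_n kill it, so it generates V. Then u = p
   (d + alpha) u, and torsion-freeness forces p (d + alpha) = 1, against degrees. *)
apply/eqP => delta0; pose w := ('X + alpha%:P) *: u.
have Xa0 : 'X + alpha%:P != 0 :> {poly K}.
  by rewrite -size_poly_eq0 size_XaddC.
have w0 : w <> 0 by move=> /torsion_free H; apply/u0/H.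
have [|p pw] := gen w w0 _ u.
  move=> n; rewrite /w scalerDl opD opX opZ.
  case: n => [|[|[|n]]].
  - by exists ('X + alpha%:P); rewrite !l0E addr0 -!scalerDl.
  - exists 1; rewrite l1u delta0 !scale0r !scaler0 add0r addr0 l0E.
    by rewrite -scalerDl scale1r.
  - by exists 0; rewrite lu l1u delta0 !(scale0r, scaler0) !addr0.
  - by exists 0; rewrite !lu !(scale0r, scaler0) !addr0.
have : (1 - p * ('X + alpha%:P)) *: u = 0.
  by rewrite scalerBl scale1r -scalerA -/w -pw subrr.
move=> /torsion_free H; case: u0; apply: H; rewrite subr_eq0 eq_sym.
apply: contraTneq (isT) => /(congr1 (size : {poly K} -> nat)).
have [->|p0] := eqVneq p 0; first by rewrite mul0r size_poly0 size_poly1.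
rewrite size_Mmonic ?monicXaddC // size_XaddC addn2 size_poly1 /= => -[] /eqP.
by rewrite size_poly_eq0 (negPf p0).
Qed.

End Classification.

(** * Identification with M_{Delta, alpha} *)

Section Isomorphism.
Variables (K : numClosedFieldType) (V : confModule (SV K)).
Local Notation P1 := {poly K}.
Variables (u : V) (Delta alpha : K).
Hypothesis u_gen : forall v, exists p : P1, v = p *: u.
Hypothesis u_free : forall p : P1, p *: u = 0 -> p = 0.
Hypothesis l0u : l_ 0 u = ('X + alpha%:P) *: u.
Hypothesis l1u : l_ 1 u = Delta%:P *: u.
Hypothesis lu : forall n, l_ n.+2 u = 0.
Hypothesis myu : forall n, y_ n u = 0 /\ m_ n u = 0.

Let ucoefs (F : vpoly P1^o) (G : vpoly V) :=
  forall n, vcoef n G = (vcoef n F : P1) *: u.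

Let ucoefsZ (q : {poly P1}) F G : ucoefs F G -> ucoefs (q *: F) (q *: G).
Proof.
move=> FG n; rewrite !vcoefZ scaler_suml; apply: eq_bigr => i _.
by rewrite FG scalerA.
Qed.

Let ucoefs_gen i : ucoefs (Mgen Delta alpha i ord0) (lact (sv_gen K i) u).
Proof.
have alg1 (p : P1) : p *: (1 : P1^o) = p by exact: mulr1.
move=> n; rewrite /Mgen; case: (ord3P i) => -> /=.
- rewrite vcoefZ_const /d2 /lam2 -polyCD coefD coefC coefCM coefX alg1.
  case: n => [|[|n]] /=.
  + by rewrite mulr0 addr0; apply: l0u.
  + by rewrite add0r mulr1; apply: l1u.
  + by rewrite mulr0 addr0 scale0r; apply: lu.
- by rewrite vcoef0 scale0r; apply: (myu n).2.
- by rewrite vcoef0 scale0r; apply: (myu n).1.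
Qed.

Lemma Mmod_iso : cm_isomorphic V (Mmod Delta alpha).
Proof.
have ex v : exists p : P1, v == p *: u by have [p ->] := u_gen v; exists p.
(* The isomorphism takes the coordinate of v in the basis [u]. *)
pose f v : P1^o := xchoose (ex v).
have fE v : v = (f v : P1) *: u by apply/eqP/(xchooseP (ex v)).
have uI (p q : P1) : p *: u = q *: u -> p = q.
  move=> /eqP; rewrite -subr_eq0 -scalerBl => /eqP/u_free/eqP.
  by rewrite subr_eq0 => /eqP.
have fK p : f ((p : P1) *: u) = p by apply: uI; rewrite -fE.
have f_linear : linear f.
  move=> p v w; apply: uI; rewrite -fE scalerDl -fE -[p *: f v]/(p * f v).
  by rewrite -scalerA -fE.
pose F := GRing.isLinear.Build _ _ _ _ f f_linear.
pose f' : {linear V -> Mmod Delta alpha} :=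
  HB.pack (f : V -> Mmod Delta alpha) F.
exists f'.
  by exists (fun p : P1 => p *: u) => [v|p] /=; rewrite ?fK // -fE.
move=> a v n; apply: uI; rewrite -fE.
suff : ucoefs (Mact Delta alpha a (f v)) (lact a v) by apply.
(* Both actions extend from generators by the same factors p(-lambda) and q(d + lambda), so
   generators suffice. *)
rewrite {2}[v]fE lact_gens => {}n.
rewrite /Mact /sesqui_ext !vcoef_sum scaler_suml; apply: eq_bigr => i _.
rewrite big_ord1 lact_polyr scalerA.
exact/ucoefsZ/ucoefs_gen.
Qed.

End Isomorphism.

(** * Classification over algebraically closed number fields in the sense of [numClosedFieldType],
    then over the complex numbers *)

Theorem confModule_classification (K : numClosedFieldType)
    (V : confModule (SV K)) :
  cm_finite V -> cm_irreducible V -> ~ cm_trivial V ->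
  exists Delta alpha : K,
    Delta != 0 /\ cm_isomorphic V (Mmod Delta alpha).
Proof.
move=> Vfin Virr Vnt.
have [u [delta [alpha [[u0 d0 ugen] l0u l1u lu myu]]]] :=
  free_generator Vfin Virr Vnt.
exists delta, alpha; split=> //; apply: (@Mmod_iso K V u) => // p pu.
have [//|p0] := eqVneq p 0; case: u0.
exact: (torsion_free Virr Vnt pu p0).
Qed.

Theorem theorem4p2 (R : realType) (V : confModule (SV R[i])) :
  cm_finite V -> cm_irreducible V -> ~ cm_trivial V ->
  exists Delta alpha : R[i],
    Delta != 0 /\ cm_isomorphic V (Mmod Delta alpha).
Proof.
exact: confModule_classification.
Qed.
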